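(* In the setting defined in the context, let $\mathbb L$ be infinite, enumerated by the positive integers, let $u_k\in\mathbb Z^n$ ($k\in\mathbb L$) be primitive vectors spanning $\mathbb R^n$ with $\beta$ continuous, and assume: (1) for any $n+1$ distinct indices in $\mathbb L$, the corresponding complex flats $H_{k,\mathbb C}$ have empty intersection; (2) $|\lambda_k|$ grows like $k^\delta$ for some $\delta>1$ (i.e. $|\lambda_k|$ lies between two positive constant multiples of $k^\delta$ for all sufficiently large $k$); (3) writing $\Lambda_k=(\Lambda_z)_k+\mathbf j(\Lambda_w)_k$ with $(\Lambda_z)_k,(\Lambda_w)_k\in\mathbb C$, there are positive constants $C_1,C_2$ independent of $k$ such that $C_1|(\Lambda_w)_k|\le|(\Lambda_z)_k|\le C_2|(\Lambda_w)_k|$ for all sufficiently large $k$. Then for every $(z,w)\in(\mu^{\mathbb C})^{-1}(0)$ and every $c\in\mathfrak n^*$, the $N^{\mathbb C}$-orbit through $(z,w)$ meets the level set $(\mu^{\mathbb R})^{-1}(c)$, and it meets it in exactly one $N$-orbit. Consequently the hyperkähler quotient $\mu^{-1}(0)/N$ is identified with the quotient $(\mu^{\mathbb C})^{-1}(0)/N^{\mathbb C}$: the map induced by the inclusion $\mu^{-1}(0)\subset(\mu^{\mathbb C})^{-1}(0)$ is a bijection.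
   Context: Construction. $\mathbb H$ denotes the quaternions. Write $x\in\mathbb H$ as $x=z+\mathbf j w$ with $z,w\in\mathbb C$. Identify $\operatorname{Im}\mathbb H\cong\mathbb R\oplus\mathbb C$ so that $\tfrac12\bar x\mathbf i x$ corresponds to $\bigl(\tfrac12(|z|^2-|w|^2),\,zw\bigr)$ (that is, $s\mathbf i+\mathbf k c\leftrightarrow(s,c)$ for $s\in\mathbb R$, $c\in\mathbb C$). Given $\Lambda=(\Lambda_k)_{k\in\mathbb L}\in\mathbb H^{\mathbb L}$, put $\lambda_k=-\tfrac12\overline{\Lambda_k}\,\mathbf i\,\Lambda_k\in\operatorname{Im}\mathbb H$ and write $\lambda_k=(\lambda_k^{\mathbb R},\lambda_k^{\mathbb C})\in\mathbb R\oplus\mathbb C$. It is assumed that $\sum_k(1+|\lambda_k|)^{-1}<\infty$. Let $L^2(\mathbb H)=\{v\in\mathbb H^{\mathbb L}:\sum_k|v_k|^2<\infty\}$ and $M_\Lambda=\Lambda+L^2(\mathbb H)$, whose points are written $(z,w)=(z_k,w_k)_{k\in\mathbb L}$. The Hilbert group $T_\lambda=\{g\in(S^1)^{\mathbb L}:\sum_k(1+|\lambda_k|)|1-g_k|^2<\infty\}$ has Lie algebra $\mathfrak t_\lambda=\{t\in\mathbb R^{\mathbb L}:\sum_k(1+|\lambda_k|)|t_k|^2<\infty\}$, a Hilbert space; its complexification is $T_\lambda^{\mathbb C}=\{g\in(\mathbb C^* )^{\mathbb L}:\sum_k(1+|\lambda_k|)|1-g_k|^2<\infty\}$. Both act on $M_\Lambda$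 by $g\cdot(z_k,w_k)=(g_kz_k,g_k^{-1}w_k)$. The hyperkähler moment map of $T_\lambda$ is $\mu_\Lambda(x)=\sum_k(\lambda_k+\tfrac12\bar x_k\mathbf i x_k)e_k^*\in\operatorname{Im}\mathbb H\otimes\mathfrak t_\lambda^*$, where $e_k$ are the standard coordinate vectors and $e_k^*$ the coordinate functionals. A vector $u\in\mathbb Z^n$ is primitive if it is non-zero and $u\notin m\mathbb Z^n$ for all integers $m>1$. $\beta:\mathfrak t_\lambda\to\mathbb R^n$ is the linear map with $\beta(e_k)=u_k$, assumed continuous. Put $\mathfrak n=\ker\beta$, $\iota:\mathfrak n\to\mathfrak t_\lambda$ the inclusion, $N=\ker(\exp\circ\beta\circ\exp^{-1}:T_\lambda\to T^n)$, and $N^{\mathbb C}=N\exp(i\mathfrak n)\subset T_\lambda^{\mathbb C}$ its complexification. The moment map of $N$ is $\mu=\iota^*\mu_\Lambda=(\mu^{\mathbb R},\mu^{\mathbb C})$, with $\mu^{\mathbb R}(z,w)=\sum_k\bigl(\lambda_k^{\mathbb R}+\tfrac12(|z_k|^2-|w_k|^2)\bigr)\iota^*e_k^*\in\mathfrak n^*$ and $\mu^{\mathbb C}(z,w)=\sum_k(\lambda_k^{\mathbb C}+z_kw_k)\iota^*e_k^*\in\mathbb C\otimes\mathfrak n^*$. Equivalently, $\mu^{\mathbb C}(z,w)=0$ iff there is $a_{\mathbb C}\in\mathbb C\otimes(\mathbb R^n)^*$ with $a_{\mathbb C}(u_k)=\lambda_k^{\mathbb C}+z_kw_k$ for all $k$.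 The hyperkähler quotient is $M(\beta,\lambda)=\mu^{-1}(0)/N$. The complex flats are $H_{k,\mathbb C}=\{b\in\mathbb C\otimes(\mathbb R^n)^*: b(u_k)=\lambda_k^{\mathbb C}\}$. *)

(* Defs.v *)
From HB Require Import structures.
From mathcomp Require Import all_boot all_order all_algebra.
From mathcomp Require Import complex.
From mathcomp Require Import all_classical all_reals all_analysis.
From mathcomp Require Import ring.

Set Implicit Arguments.
Unset Strict Implicit.
Unset Printing Implicit Defensive.

Import Order.TTheory GRing.Theory Num.Theory numFieldNormedType.Exports.
Import Normc.

Local Open Scope classical_set_scope.
Local Open Scope ring_scope.
Local Open Scope complex_scope.

(* The index set is nat, with k : nat standing for the positive integer k.+1. *)

Section Quaternions.
Context {R : realType}.

(* The pair (z, w) is the quaternion z + j w, where c j = j c^* for c complex.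
   Addition is componentwise, but the componentwise product that pairs
   inherit from the library is NOT the quaternion product, which is qmul. *)
Definition quat : Type := (R[i] * R[i])%type.

Definition qmul (x y : quat) : quat :=
  (x.1 * y.1 - x.2^*%C * y.2, x.1^*%C * y.2 + x.2 * y.1).

Definition qconj (x : quat) : quat := (x.1^*%C, - x.2).

Definition qi : quat := ('i, 0).

Definition qscale (a : R) (x : quat) : quat := (a%:C * x.1, a%:C * x.2).

Definition qnorm (x : quat) : R := Num.sqrt (normc x.1 ^+ 2 + normc x.2 ^+ 2).

(* Im H = R (+) C, where (s, c) stands for i s + k c. As k = - j i, the
   quaternion i s + k c is (i s) + j (- i c), hence c = i w. *)
Definition imR (x : quat) : R := complex.Im x.1.
Definition imC (x : quat) : R[i] := 'i * x.2.

(* (1/2) conj(x) i x *)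
Definition qhopf (x : quat) : quat := qscale 2^-1 (qmul (qmul (qconj x) qi) x).

Lemma imR_qhopf (x : quat) :
  imR (qhopf x) = 2^-1 * (normc x.1 ^+ 2 - normc x.2 ^+ 2).
Proof.
case: x => -[a b] [c d]; rewrite /imR /normc /=.
by rewrite !sqr_sqrtr ?addr_ge0 ?sqr_ge0//; ring.
Qed.

Lemma imC_qhopf (x : quat) : imC (qhopf x) = x.1 * x.2.
Proof.
have half (s : R) : 2^-1 * (s + s) = s by field.
case: x => -[a b] [c d]; rewrite /imC /=.
apply/eqP; rewrite eq_complex /=; apply/andP; split; apply/eqP;
  rewrite -[RHS]half; ring.
Qed.

End Quaternions.

Arguments quat R : clear implicits.

Section Sequences.
Context {R : realType}.

(* For nonnegative terms: the sum is finite. *)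
Definition summable_seq (a : nat -> R) : Prop := cvgn (series a).

(* e^(i zeta). The circle is R / 2 pi Z, with exponential theta |-> e^(i theta),
   and zeta |-> e^(i zeta) is its complexification. *)
Definition expi (zeta : R[i]) : R[i] :=
  (expR (- complex.Im zeta))%:C *
  (cos (complex.Re zeta) +i* sin (complex.Re zeta)).

Definition texp (zeta : nat -> R[i]) : nat -> R[i] := fun k => expi (zeta k).

Definition primitive n (v : 'rV[int]_n) : Prop :=
  v != 0 /\ forall m : int, 1 < m -> ~ exists v' : 'rV[int]_n, v = m *: v'.

Definition real_row n (v : 'rV[int]_n) : 'rV[R]_n := map_mx intr v.

Definition spanning n (u : nat -> 'rV[int]_n) : Prop :=
  forall v : 'rV[R]_n, exists (m : nat) (a : 'I_m -> R),
    v = \sum_(k < m) a k *: real_row (u k).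

Definition coord_vec (k : nat) : nat -> R := fun j => (j == k)%:R.

End Sequences.

Section Hyperkahler.
Context {R : realType}.
Variable Lam : nat -> quat R.

Definition lambda (k : nat) : quat R := - qhopf (Lam k).

Definition weight (k : nat) : R := 1 + qnorm (lambda k).

Definition M_Lam : set (nat -> quat R) :=
  [set x | summable_seq (fun k => qnorm (x k - Lam k) ^+ 2)].

Definition T_lam : set (nat -> R[i]) :=
  [set g | (forall k, normc (g k) = 1) /\
           summable_seq (fun k => weight k * normc (1 - g k) ^+ 2)].

Definition t_lam : set (nat -> R) :=
  [set t | summable_seq (fun k => weight k * `|t k| ^+ 2)].

Definition t_norm (t : nat -> R) : R :=
  Num.sqrt (limn (series (fun k => weight k * `|t k| ^+ 2))).

(* Maps out of a linear subspace A of t_lam are given by functions on all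
   sequences; their values outside A are irrelevant. *)
Definition linear_on (V : lmodType R) (A : set (nat -> R))
    (f : (nat -> R) -> V) : Prop :=
  forall (a : R) (s t : nat -> R), A s -> A t ->
    f (fun k => a * s k + t k) = a *: f s + f t.

Definition continuous_on (V : normedModType R) (A : set (nat -> R))
    (f : (nat -> R) -> V) : Prop :=
  forall t, A t -> forall e : R, 0 < e -> exists2 d : R, 0 < d &
    forall s, A s -> t_norm (fun k => s k - t k) < d -> `|f s - f t| < e.

Definition in_dual (A : set (nat -> R)) (c : (nat -> R) -> R) : Prop :=
  linear_on (V := R) A c /\ continuous_on (V := R) A c.

Definition act (g : nat -> R[i]) (x : nat -> quat R) : nat -> quat R :=
  fun k => (g k * (x k).1, (g k)^-1 * (x k).2).

Definition orbit_of (G : set (nat -> R[i])) (x : nat -> quat R) :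
    set (nat -> quat R) := [set act g x | g in G].

(* The k-th coefficient lambda_k + (1/2) conj(x_k) i x_k of mu_Lambda(x). *)
Definition mu_coef (x : nat -> quat R) (k : nat) : quat R :=
  lambda k + qhopf (x k).

Lemma imR_mu_coef x k : imR (mu_coef x k) =
  imR (lambda k) + 2^-1 * (normc (x k).1 ^+ 2 - normc (x k).2 ^+ 2).
Proof. by rewrite -imR_qhopf /imR /mu_coef /= raddfD. Qed.

Lemma imC_mu_coef x k :
  imC (mu_coef x k) = imC (lambda k) + (x k).1 * (x k).2.
Proof. by rewrite -imC_qhopf /imC /mu_coef /= mulrDr. Qed.

(* mu(x), a functional on the Lie algebra of N, evaluated at t. *)
Definition muR (x : nat -> quat R) (t : nat -> R) : R :=
  limn (series (fun k => imR (mu_coef x k) * t k)).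

(* R[i]^o carries the norm topology of the complex numbers. *)
Definition muC (x : nat -> quat R) (t : nat -> R) : R[i] :=
  limn (series (fun k => (imC (mu_coef x k) * (t k)%:C : R[i]^o))).

(* C (x) (R^n)^* is 'cV[R[i]]_n, through the coordinates on R^n. *)
Definition flat n (u : nat -> 'rV[int]_n) (k : nat) : set 'cV[R[i]]_n :=
  [set b | (map_mx intr (u k) *m b) 0 0 = imC (lambda k)].

Section Quotient.
Variables (n : nat) (beta : (nat -> R) -> 'rV[R]_n).

Definition lie_N : set (nat -> R) := [set t | t_lam t /\ beta t = 0].

(* The kernel of exp o beta o exp^-1; for u integral the value of this map on
   g does not depend on the choice of the logarithm t of g. *)
Definition grp_N : set (nat -> R[i]) :=
  [set g | T_lam g /\ exists t, [/\ t_lam t, texp (fun k => (t k)%:C) = g &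
    forall i, expi ((beta t 0 i)%:C) = 1]].

Definition grp_NC : set (nat -> R[i]) :=
  [set h | exists g t, [/\ grp_N g, lie_N t &
    h = fun k => g k * texp (fun j => 'i * (t j)%:C) k]].

Definition muR_level (c : (nat -> R) -> R) : set (nat -> quat R) :=
  [set x | M_Lam x /\ forall t, lie_N t -> muR x t = c t].

Definition muC_zero : set (nat -> quat R) :=
  [set x | M_Lam x /\ forall t, lie_N t -> muC x t = 0].

Definition mu_zero : set (nat -> quat R) :=
  muR_level (fun=> 0) `&` muC_zero.

End Quotient.

End Hyperkahler.

(* Main.v *)
(** On an N^C-orbit only the factors exp(i t), t in n, matter for mu^R, and
    mu^R(exp(i t) x) - c is minus the differential at t of the energy
      sum_k (|z_k|^2 E(-2 t_k) + |w_k|^2 E(2 t_k)) / 4 + (c - mu^R(x))(t),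
    where E(y) = e^y - 1 - y.  So one needs that this convex function has
    exactly one critical point on n.  Balancedness of Lambda and
    summability make |z_k|^2 and |w_k|^2 comparable with 1 + |lambda_k| for all
    large k, so the energy is finite, and strongly convex in the coordinates
    with z_k w_k <> 0.  The other coordinates belong to flats through the point
    a_C given by mu^C(x) = 0; by the hypothesis on the flats the corresponding
    u_k are linearly independent, hence on n = ker beta these coordinates are
    controlled by the remaining ones.  The energy is thus strongly convex on n,
    minimizing sequences are Cauchy, and the minimizer is the unique critical
    point. *)

Require Import Defs.
From HB Require Import structures.
From mathcomp Require Import all_boot all_order all_algebra.
From mathcomp Require Import complex.
From mathcomp Require Import all_classical all_reals all_analysis.
From mathcomp Require Import ring lra zify.

Set Implicit Arguments.
Unset Strict Implicit.
Unset Printing Implicit Defensive.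

Import Order.TTheory GRing.Theory Num.Theory numFieldNormedType.Exports.
Import Normc.

Local Open Scope classical_set_scope.
Local Open Scope ring_scope.

(** The space [n] may be infinite-dimensional, so a bounded minimizing sequence need not have a
    convergent subsequence; convergence has to come from a convexity modulus that does not depend on
    the base point. Such a modulus exists because each coordinate carries both exponentials:
    [A e^(-2y) + B e^(2y)] is at least [2 min(A, B)] for every [y], whereas either term alone decays
    on one side. The linear part is removed from the exponentials in [E] because [sum |z_k|^2 |t_k|]
    can diverge on [t_lam], while the quadratic remainder is summable; the first-order part is
    carried by [c - mu^R(x)], which is bounded since lambda cancels the contribution of Lambda. As
    the weights are at least 1, each coordinate is bounded by the Hilbert norm, so the exponentials
    are bounded on balls. Differentiation under the sum is replaced by an exact Taylor formula with
    nonnegative remainder. *)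

(** * Summable real series *)

Section RealSums.
Context {R : realType}.
Implicit Types a b : nat -> R.

Lemma ssum_partial a N : (forall k, 0 <= a k) -> summable_seq a ->
  \sum_(0 <= k < N) a k <= limn (series a).
Proof.
move=> a0 ca; apply: (nondecreasing_cvgn_le _ ca).
exact: nondecreasing_series.
Qed.

Lemma ssum_ge0 a : (forall k, 0 <= a k) -> summable_seq a ->
  0 <= limn (series a).
Proof. by move=> a0 ca; have := ssum_partial 0%N a0 ca; rewrite big_geq. Qed.

Lemma ssum_bounded a M : (forall k, 0 <= a k) ->
  (forall N, \sum_(0 <= k < N) a k <= M) ->
  summable_seq a /\ limn (series a) <= M.
Proof.
move=> a0 aM.
have ca : summable_seq a.
  apply: nondecreasing_is_cvgn; first exact: nondecreasing_series.
  by exists M => _ [N _ <-]; exact: aM.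
by split=> //; apply: limr_le => //; apply: nearW => N; exact: aM.
Qed.

Lemma summable_seq_le a b : (forall k, `|a k| <= b k) ->
  summable_seq b -> summable_seq a.
Proof.
move=> ab cb; apply: normed_cvg; apply: series_le_cvg cb => //= k.
exact: le_trans (ab k).
Qed.

Lemma summable_seqD a b : summable_seq a -> summable_seq b ->
  summable_seq (fun k => a k + b k).
Proof. exact: is_cvg_seriesD. Qed.

Lemma ssumD a b : summable_seq a -> summable_seq b ->
  limn (series (fun k => a k + b k)) = limn (series a) + limn (series b).
Proof. exact: lim_seriesD. Qed.

Lemma summable_seqZ (r : R) a : summable_seq a -> summable_seq (fun k => r * a k).
Proof. exact: is_cvg_seriesZ. Qed.

Lemma ssumZ (r : R) a : summable_seq a ->
  limn (series (fun k => r * a k)) = r * limn (series a).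
Proof. exact: lim_seriesZ. Qed.

Lemma ssumB a b : summable_seq a -> summable_seq b ->
  limn (series (fun k => a k - b k)) = limn (series a) - limn (series b).
Proof. exact: lim_seriesB. Qed.

Lemma ssum_norm_le a b : (forall k, `|a k| <= b k) -> summable_seq b ->
  `|limn (series a)| <= limn (series b).
Proof.
move=> ab cb; have ca := summable_seq_le ab cb.
have cn : cvgn [normed series a].
  by apply: (summable_seq_le _ cb) => // k; rewrite normr_id.
by apply: le_trans (lim_series_norm cn) _; apply: lim_series_le.
Qed.

End RealSums.

(** * Estimates for the second-order remainder of the exponential *)

Section Exponential.
Context {R : realType}.
Implicit Types x y : R.

Definition expR_rem x := expR x - 1 - x.

Lemma expR_rem_ge0 x : 0 <= expR_rem x.
Proof. by have := expR_ge1Dx x; rewrite /expR_rem; lra. Qed.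

Lemma expR_mul1B_le1 x : expR x * (1 - x) <= 1.
Proof.
have h := expR_ge1Dx (- x); have e0 := expR_gt0 x.
by rewrite -[leRHS](expRxMexpNx_1 x) ler_pM2l.
Qed.

Lemma expR_sub1_le x : `|expR x - 1| <= `|x| * expR `|x|.
Proof.
have [x0|x0] := leP 0 x.
  have e1 : 1 <= expR x by rewrite -expR0 ler_expR.
  rewrite !ger0_norm ?subr_ge0//.
  have := expR_mul1B_le1 x; lra.
have e1 : expR x <= 1 by rewrite expR_le1 ltW.
rewrite (ler0_norm (_ : expR x - 1 <= 0)) ?subr_le0// (ltr0_norm x0).
have := expR_ge1Dx x.
have : 1 <= expR (- x) by rewrite -expR0 ler_expR; lra.
nra.
Qed.

(** The exponential factor makes the bound global. On a sequence in the weighted l^2 space every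
    coordinate is at most the norm, so this factor becomes one constant. *)
Lemma expR_rem_le x : expR_rem x <= x ^+ 2 * expR `|x|.
Proof.
have [x0|x0] := leP 0 x.
  have := expR_sub1_le x; rewrite (ger0_norm x0).
  have e1 : 1 <= expR x by rewrite -expR0 ler_expR.
  rewrite ger0_norm ?subr_ge0// /expR_rem => h.
  have h1 : expR x * (1 - x) <= 1 by lra.
  have -> : x ^+ 2 * expR x = x * (x * expR x) by ring.
  apply: (@le_trans _ _ (x * (expR x - 1))); first lra.
  exact: ler_wpM2l.
rewrite (ltr0_norm x0) /expR_rem.
have e1 := expR_ge1Dx x.
have e2 := expR_mul1B_le1 x.
have e3 : 1 <= expR (- x) by rewrite -expR0 ler_expR; lra.
apply: (@le_trans _ _ (x ^+ 2)); first nra.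
by rewrite ler_peMr ?sqr_ge0.
Qed.

(** The sum is [(e^(x/2) - e^(-x/2))^2], and [|e^y - e^(-y)| >= |y|]. Both signs are involved
    because the remainder at [x] alone grows only linearly as [x] tends to minus infinity. *)
Lemma expR_rem_coercive x : x ^+ 2 / 4 <= expR_rem x + expR_rem (- x).
Proof.
rewrite /expR_rem.
have half : x = x / 2 + x / 2 by field.
set y := x / 2 in half *.
have -> : expR x = expR y ^+ 2 by rewrite {1}half expRD expr2.
have -> : expR (- x) = expR (- y) ^+ 2.
  by rewrite {1}half opprD expRD expr2.
have p1 := expRxMexpNx_1 y.
have -> : x ^+ 2 / 4 = y ^+ 2 by rewrite /y; field.
have : y ^+ 2 <= (expR y - expR (- y)) ^+ 2.
  rewrite -[leLHS]real_normK ?num_real// -[leRHS]real_normK ?num_real//.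
  rewrite ler_sqr ?nnegrE//.
  have [y0|y0] := leP 0 y.
    have e1 := expR_ge1Dx y.
    have e2 : expR (- y) <= 1 by rewrite expR_le1; lra.
    rewrite !ger0_norm//; lra.
  have e1 := expR_ge1Dx (- y).
  have e2 : expR y <= 1 by rewrite expR_le1; lra.
  rewrite !ler0_norm//; lra.
rewrite sqrrB p1; lra.
Qed.

End Exponential.

(** * Weighted l^2 spaces, their bounded functionals and completeness *)

Section WeightedSequences.
Context {R : realType}.
Variable W : nat -> R.
Hypothesis W1 : forall k, 1 <= W k.
Implicit Types (s t f : nat -> R).

Definition subspace (A : set (nat -> R)) : Prop :=
  A (fun=> 0) /\
  forall (a : R) s t, A s -> A t -> A (fun k => a * s k + t k).

Definition wl2 : set (nat -> R) :=
  [set t | summable_seq (fun k => W k * `|t k| ^+ 2)].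

Definition wsq t : R := limn (series (fun k => W k * `|t k| ^+ 2)).

Definition wnorm t : R := Num.sqrt (wsq t).

Lemma subspaceZ A a t : subspace A -> A t -> A (fun k => a * t k).
Proof.
move=> [A0 AL] At; have := AL a _ _ At A0.
by congr A; apply: funext => k; rewrite addr0.
Qed.

Lemma subspaceD A s t : subspace A -> A s -> A t -> A (fun k => s k + t k).
Proof.
move=> [A0 AL] As At; have := AL 1 _ _ As At.
by congr A; apply: funext => k; rewrite mul1r.
Qed.

Lemma subspaceB A s t : subspace A -> A s -> A t -> A (fun k => s k - t k).
Proof.
move=> [A0 AL] As At; have := AL (- 1) _ _ At As.
by congr A; apply: funext => k; rewrite mulN1r addrC.
Qed.

Lemma linear_on0 (V : lmodType R) A (f : _ -> V) : subspace A ->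
  linear_on A f -> f (fun=> 0) = 0.
Proof.
move=> [A0 _] fL; have := fL 1 _ _ A0 A0.
rewrite (_ : (fun k : nat => _) = (fun=> 0 : R)); last first.
  by apply: funext => k; rewrite mulr0 addr0.
by rewrite scale1r -[LHS]addr0 => /addrI.
Qed.

Lemma linear_onZ (V : lmodType R) A (f : _ -> V) a t : subspace A ->
  linear_on A f -> A t -> f (fun k => a * t k) = a *: f t.
Proof.
move=> sA fL At; have := fL a _ _ At sA.1.
rewrite (linear_on0 sA fL) addr0 => <-; congr f.
by apply: funext => k; rewrite addr0.
Qed.

Lemma linear_onD (V : lmodType R) A (f : _ -> V) s t :
  linear_on A f -> A s -> A t -> f (fun k => s k + t k) = f s + f t.
Proof.
move=> fL As At; have := fL 1 _ _ As At; rewrite scale1r => <-; congr f.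
by apply: funext => k; rewrite mul1r.
Qed.

Lemma linear_onB (V : lmodType R) A (f : _ -> V) s t :
  linear_on A f -> A s -> A t -> f (fun k => s k - t k) = f s - f t.
Proof.
move=> fL As At; have := fL (-1) _ _ At As.
rewrite scaleN1r addrC => <-; congr f.
by apply: funext => k; rewrite mulN1r addrC.
Qed.

Let W0 k : 0 < W k. Proof. exact: lt_le_trans (W1 k). Qed.

Lemma wterm_ge0 t k : 0 <= W k * `|t k| ^+ 2.
Proof. by rewrite mulr_ge0 ?sqr_ge0// ltW. Qed.

Lemma wl2_subspace : subspace wl2.
Proof.
split.
  suff [] : summable_seq (fun k => W k * `|0 : R| ^+ 2) /\
    limn (series (fun k => W k * `|0 : R| ^+ 2)) <= 0 by [].
  apply: ssum_bounded => [k|N]; first exact: (wterm_ge0 (fun=> 0)).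
  by rewrite big1// => k _; rewrite normr0 expr0n/= mulr0.
move=> a s t ss tt.
apply: (summable_seq_le (b := fun k => (2 * a ^+ 2) * (W k * `|s k| ^+ 2) +
                                2 * (W k * `|t k| ^+ 2))).
  move=> k; rewrite ger0_norm ?(wterm_ge0 (fun k => a * s k + t k) k)//.
  rewrite !real_normK ?num_real//.
  have -> : 2 * a ^+ 2 * (W k * s k ^+ 2) + 2 * (W k * t k ^+ 2) =
    W k * (2 * a ^+ 2 * s k ^+ 2 + 2 * t k ^+ 2) by ring.
  rewrite ler_pM2l//.
  by have := sqr_ge0 (a * s k - t k); nra.
exact: (summable_seqD (summable_seqZ ss) (summable_seqZ tt)).
Qed.

Lemma wsq_ge0 t : wl2 t -> 0 <= wsq t.
Proof. by move=> tt; apply: ssum_ge0 => // k; exact: wterm_ge0. Qed.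

Lemma wnorm_ge0 t : 0 <= wnorm t.
Proof. exact: sqrtr_ge0. Qed.

Lemma wnorm_sqr t : wl2 t -> wnorm t ^+ 2 = wsq t.
Proof. by move=> tt; rewrite sqr_sqrtr// wsq_ge0. Qed.

Lemma wsqZ a t : wl2 t -> wsq (fun k => a * t k) = a ^+ 2 * wsq t.
Proof.
move=> tt; rewrite -ssumZ//; congr (limn (series _)).
by apply: funext => k; rewrite !real_normK ?num_real//; ring.
Qed.

Lemma wnormZ a t : wl2 t -> wnorm (fun k => a * t k) = `|a| * wnorm t.
Proof. by move=> tt; rewrite /wnorm wsqZ// sqrtrM ?sqr_ge0// sqrtr_sqr. Qed.

Lemma wsq_coord t k : wl2 t -> W k * `|t k| ^+ 2 <= wsq t.
Proof.
move=> tt; have := ssum_partial k.+1 (wterm_ge0 t) tt.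
rewrite big_nat_recr//=; apply: le_trans; rewrite lerDr.
by apply: sumr_ge0 => i _; exact: wterm_ge0.
Qed.

Lemma wnorm_coord t k : wl2 t -> `|t k| <= wnorm t.
Proof.
move=> tt; rewrite -[leLHS]ger0_norm// -sqrtr_sqr ler_wsqrtr//.
apply: le_trans (wsq_coord k tt).
by rewrite ler_peMl ?sqr_ge0.
Qed.

(** Scale [t] into the ball of radius [d] and use homogeneity. The factor is [d / (wnorm t + y)]
    with [y > 0], which covers [wnorm t = 0] and keeps the scaled norm strictly below [d]. *)
Lemma linear_bounded (V : normedModType R) A (f : _ -> V) d e :
    subspace A -> A `<=` wl2 -> linear_on A f -> 0 < d ->
    (forall t, A t -> wnorm t < d -> `|f t| <= e) ->
  forall t, A t -> `|f t| <= e / d * wnorm t.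
Proof.
move=> sA Awl fL d0 fe t At; have wt := Awl _ At.
apply/ler_addgt0Pr => x x0.
have e0 : 0 <= e.
  apply: le_trans (fe _ sA.1 _); first by [].
  rewrite (_ : (fun=> _) = (fun k => 0 * t k)); last first.
    by apply: funext => k; rewrite mul0r.
  by rewrite wnormZ// normr0 mul0r.
have q0 := wnorm_ge0 t.
(* Makes the excess [e y / d] equal to [x e / (e + 1)], which is at most [x]; the [+ 1] covers
   [e = 0]. *)
pose y := x * d / (e + 1).
have y0 : 0 < y by rewrite divr_gt0 ?mulr_gt0//; lra.
have qy0 : 0 < wnorm t + y by lra.
pose c := d / (wnorm t + y).
have c0 : 0 < c by rewrite divr_gt0.
have /fe : A (fun k => c * t k) by apply: subspaceZ.
rewrite wnormZ// gtr0_norm// => /(_ _)/le_trans.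
rewrite (linear_onZ _ sA fL)// normrZ gtr0_norm//.
move=> h.
have : c * `|f t| <= e.
  apply: h => //; rewrite /c mulrAC ltr_pdivrMr// ltr_pM2l//; lra.
rewrite -ler_pdivlMl// /c invf_div => /le_trans; apply.
have -> : (wnorm t + y) / d * e = e / d * wnorm t + x * (e / (e + 1)).
  by rewrite /y; field; rewrite !gt_eqF//; lra.
rewrite lerD2l ler_piMr ?(ltW x0)// ler_pdivrMr; lra.
Qed.

(** Termwise AM-GM: [2 |f t| <= f^2 / W + W t^2]. Finiteness of [sum f^2 / W] is membership of [f]
    in the dual of the weighted space. *)
Lemma dual_summable f t : summable_seq (fun k => f k ^+ 2 / W k) -> wl2 t ->
  summable_seq (fun k => f k * t k) /\
  `|limn (series (fun k => f k * t k))| <=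
    (limn (series (fun k => f k ^+ 2 / W k)) + wsq t) / 2.
Proof.
move=> cf ct.
have c2 := summable_seqD cf ct.
have fb k : `|f k * t k| <= 2^-1 * (f k ^+ 2 / W k + W k * `|t k| ^+ 2).
  have Wk := W0 k; rewrite normrM -(real_normK (num_real (f k))).
  set p := `|f k|; set q := `|t k|.
  rewrite ler_pdivlMl// -subr_ge0.
  have -> : p ^+ 2 / W k + W k * q ^+ 2 - 2 * (p * q) = (p - W k * q) ^+ 2 / W k.
    by field; rewrite gt_eqF.
  by rewrite divr_ge0 ?sqr_ge0// ltW.
have ch := summable_seqZ (r := 2^-1) c2.
split; first exact: summable_seq_le ch.
by apply: le_trans (ssum_norm_le fb ch) _; rewrite ssumZ// ssumD// mulrC.
Qed.

Lemma dual_linear f : summable_seq (fun k => f k ^+ 2 / W k) ->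
  linear_on (V := R) wl2 (fun t => limn (series (fun k => f k * t k))).
Proof.
move=> cf a s t ss tt.
have [cs _] := dual_summable cf ss; have [ct _] := dual_summable cf tt.
rewrite (_ : (fun k => _) = fun k => a * (f k * s k) + f k * t k).
  by rewrite ssumD ?ssumZ//; exact: summable_seqZ.
by apply: funext => k; ring.
Qed.

Lemma dual_bounded f : summable_seq (fun k => f k ^+ 2 / W k) ->
  exists M, forall t, wl2 t ->
    `|limn (series (fun k => f k * t k))| <= M * wnorm t.
Proof.
move=> cf; set P := limn (series (fun k => f k ^+ 2 / W k)).
(* On the unit ball the AM-GM bound is at most [(P + 1) / 2]; the final [/ 1] is the radius in
   [linear_bounded]. *)
exists ((P + 1) / 2 / 1).
apply: (linear_bounded (V := R) wl2_subspace _ (dual_linear cf)) => // t tt q1.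
apply: le_trans (dual_summable cf tt).2 _; rewrite -/P.
rewrite ler_pM2r// lerD2l -(wnorm_sqr tt) -(expr1n _ 2).
by rewrite ler_sqr ?nnegrE ?wnorm_ge0// ltW.
Qed.

(* Fatou: the bound on [T m - T p] passes to the coordinatewise limit in p. *)
Lemma wl2_complete (T : nat -> nat -> R) (r : nat -> R) :
    r @ \oo --> (0 : R) -> (forall m, wl2 (T m)) ->
    (forall m p, wsq (fun k => T m k - T p k) <= r m + r p) ->
  exists2 t, wl2 t & forall m, wsq (fun k => T m k - t k) <= r m.
Proof.
move=> r0 wT Tr.
have wTB m p : wl2 (fun k => T m k - T p k).
  by apply: (subspaceB wl2_subspace).
have cvT k : cvgn (fun m => T m k : R^o).
  apply/cauchy_cvgP/cauchy_exP => e e0.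
  have e2 : 0 < e ^+ 2 / 2 by rewrite divr_gt0// exprn_gt0.
  have /cvgrPdist_lt/(_ _ e2) [N _ rN] := r0.
  exists (T N k); exists N => // p /= Np.
  suff : `|T N k - T p k| < e by [].
  rewrite -ltr_sqr ?nnegrE ?(ltW e0)//.
  apply: (@le_lt_trans _ _ (r N + r p)).
    apply: le_trans (Tr N p); apply: le_trans (wsq_coord k (wTB N p)).
    by rewrite ler_peMl ?sqr_ge0.
  have := rN N (leqnn N); have := rN p Np; rewrite !sub0r !normrN.
  by rewrite !ltr_norml; lra.
pose t k : R := limn (fun m => T m k : R^o).
have bnd m N : \sum_(0 <= k < N) W k * `|T m k - t k| ^+ 2 <= r m.
  have h1 : (\sum_(0 <= k < N) W k * `|T m k - T p k| ^+ 2 : R^o) @[p --> \oo]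
      --> (\sum_(0 <= k < N) W k * `|T m k - t k| ^+ 2 : R^o).
    apply: cvg_big => [|k _]; first exact: add_continuous.
    apply: cvgMr.
    rewrite expr2; apply: cvgM; apply: cvg_norm; apply: cvgB => //;
      try exact: cvg_cst; exact: cvT.
  have h2 : (r m + r p : R^o) @[p --> \oo] --> (r m + 0 : R^o).
    by apply: cvgD => //; exact: cvg_cst.
  rewrite -[leRHS]addr0.
  apply: (ler_cvg_to h1 h2); apply: nearW => p.
  apply: le_trans (Tr m p).
  exact: (ssum_partial N (wterm_ge0 (fun k => T m k - T p k)) (wTB m p)).
have lim m : wl2 (fun k => T m k - t k) /\ wsq (fun k => T m k - t k) <= r m.
  by apply: ssum_bounded => [k|N]; [exact: wterm_ge0 (fun k => T m k - t k) k|exact: bnd].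
exists t => [|m]; last exact: (lim m).2.
have := subspaceB wl2_subspace (wT 0%N) (lim 0%N).1.
by congr wl2; apply: funext => k; rewrite subKr.
Qed.

End WeightedSequences.

(** * Convex functions that are sums over the coordinates *)

Section DiagonalConvex.
Context {R : realType}.
Variables (W A B : nat -> R) (C : R).
Hypothesis W1 : forall k, 1 <= W k.
Hypothesis AB0 : forall k, 0 <= A k /\ 0 <= B k.
Hypothesis ABC : forall k, A k <= C * W k /\ B k <= C * W k.
Implicit Types (t h s : nat -> R).

Let W0 k : 0 < W k. Proof. exact: lt_le_trans (W1 k). Qed.

Let C0 : 0 <= C.
Proof. by have [A0 _] := AB0 0; have [AC _] := ABC 0; have := W0 0; nra. Qed.

(** The derivative of [pot k]. With [A = |z|^2 / 2] and [B = |w|^2 / 2] it is the amount by which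
    the k-th coefficient of mu^R drops under exp(i y). *)
Definition grad k (y : R) : R :=
  A k * (1 - expR (- (2 * y))) + B k * (expR (2 * y) - 1).

Definition pot k (y : R) : R :=
  (A k * expR_rem (- (2 * y)) + B k * expR_rem (2 * y)) / 2.

(* Bregman remainder of pot k. *)
Definition breg k (y z : R) : R :=
  (A k * expR (- (2 * y)) * expR_rem (- (2 * z))
   + B k * expR (2 * y) * expR_rem (2 * z)) / 2.

(** An exact Taylor formula, from [E(a + b) = E(a) + (e^a - 1) b + e^a E(b)]. *)
Lemma pot_add k y z : pot k (y + z) = pot k y + grad k y * z + breg k y z.
Proof.
rewrite /pot /grad /breg /expR_rem.
by rewrite !(mulrDr 2) opprD !expRD; field.
Qed.

Lemma pot_breg k y : pot k y = breg k 0 y.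
Proof. by rewrite /pot /breg mulr0 oppr0 expR0 !mulr1. Qed.

Lemma breg_ge0 k y z : 0 <= breg k y z.
Proof.
have [A0 B0] := AB0 k.
by rewrite divr_ge0// addr_ge0// !mulr_ge0 ?expR_ge0 ?expR_rem_ge0.
Qed.

Lemma expR_le_abs (y : R) : expR y <= expR `|y|.
Proof. by rewrite ler_expR ler_norm. Qed.

Let norm2 (y : R) : `|2 * y| = 2 * `|y|.
Proof. by rewrite normrM ger0_norm. Qed.

Lemma breg_le k y z :
  breg k y z <= 4 * C * expR (2 * `|y|) * expR (2 * `|z|) * (W k * `|z| ^+ 2).
Proof.
have [A0 B0] := AB0 k; have [AC BC] := ABC k.
have ey1 := expR_le_abs (2 * y); have ey2 := expR_le_abs (- (2 * y)).
have ez1 := expR_rem_le (2 * z); have ez2 := expR_rem_le (- (2 * z)).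
rewrite ?normrN norm2 in ey1 ey2.
rewrite ?normrN norm2 in ez1 ez2.
set X := expR (2 * `|y|) in ey1 ey2 *.
set Z := expR (2 * `|z|) in ez1 ez2 *.
have bound (a e r : R) : 0 <= a -> a <= C * W k -> 0 <= e -> e <= X ->
    0 <= r -> r <= 4 * `|z| ^+ 2 * Z ->
    a * e * r <= C * W k * X * (4 * `|z| ^+ 2 * Z).
  by move=> *; rewrite ler_pM ?mulr_ge0// ler_pM.
have rz2 : `|z| ^+ 2 = z ^+ 2 by rewrite real_normK ?num_real.
have h1 : A k * expR (- (2 * y)) * expR_rem (- (2 * z)) <=
    C * W k * X * (4 * `|z| ^+ 2 * Z).
  apply: bound; rewrite ?expR_ge0 ?expR_rem_ge0//.
  by apply: le_trans ez2 _; rewrite rz2 sqrrN exprMn; lra.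
have h2 : B k * expR (2 * y) * expR_rem (2 * z) <=
    C * W k * X * (4 * `|z| ^+ 2 * Z).
  apply: bound; rewrite ?expR_ge0 ?expR_rem_ge0//.
  by apply: le_trans ez1 _; rewrite rz2 exprMn; lra.
rewrite /breg ler_pdivrMr//; lra.
Qed.

Lemma grad_le k y : `|grad k y| <= 4 * C * expR (2 * `|y|) * (W k * `|y|).
Proof.
have [A0 B0] := AB0 k; have [AC BC] := ABC k.
have e1 := expR_sub1_le (2 * y); have e2 := expR_sub1_le (- (2 * y)).
rewrite ?normrN norm2 in e1 e2.
rewrite /grad; apply: le_trans (ler_normD _ _) _.
rewrite !normrM (ger0_norm A0) (ger0_norm B0) (distrC 1).
set X := expR (2 * `|y|) in e1 e2 *.
have := ler_pM A0 (normr_ge0 _) AC e2; have := ler_pM B0 (normr_ge0 _) BC e1.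
lra.
Qed.

(** Adding the directions [z] and [-z] gives both terms the common factor [E(2z) + E(-2z) >= z^2].
    What is left, [(A e^(-2y) + B e^(2y)) / 2], is at least [c W] for every [y], since
    [e^(-2y) + e^(2y) >= 2]. *)
Lemma breg_coercive c k y z : 0 <= c -> c * W k <= A k -> c * W k <= B k ->
  c * (W k * `|z| ^+ 2) <= breg k y z + breg k y (- z).
Proof.
move=> c0 cA cB; have cW : 0 <= c * W k by rewrite mulr_ge0// ltW.
rewrite real_normK ?num_real//.
have ez := expR_rem_coercive (2 * z).
have ey := expR_rem_coercive (2 * y).
set P := expR_rem (2 * z) + _ in ez.
have -> : breg k y z + breg k y (- z) =
    (A k * expR (- (2 * y)) + B k * expR (2 * y)) * P / 2.
  by rewrite /breg /P mulrN opprK; field.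
have e2 : 2 <= expR (- (2 * y)) + expR (2 * y).
  by move: ey; rewrite /expR_rem; have := sqr_ge0 (2 * y); lra.
have p1 : z ^+ 2 <= P by lra.
have p2 : c * W k * 2 <= A k * expR (- (2 * y)) + B k * expR (2 * y).
  apply: (@le_trans _ _ (c * W k * expR (- (2 * y)) + c * W k * expR (2 * y))).
    by rewrite -mulrDr ler_wpM2l.
  by rewrite lerD// ler_wpM2r ?expR_ge0.
rewrite ler_pdivlMr// mulrA mulrAC.
by apply: ler_pM => //; rewrite ?sqr_ge0// mulr_ge0.
Qed.

Lemma summable_breg t h : wl2 W t -> wl2 W h ->
  summable_seq (fun k => breg k (t k) (h k)) /\
  limn (series (fun k => breg k (t k) (h k))) <=
    4 * C * expR (2 * wnorm W t) * expR (2 * wnorm W h) * wsq W h.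
Proof.
move=> wt wh.
pose K := 4 * C * expR (2 * wnorm W t) * expR (2 * wnorm W h).
have bK k : `|breg k (t k) (h k)| <= K * (W k * `|h k| ^+ 2).
  rewrite ger0_norm ?breg_ge0//; apply: le_trans (breg_le _ _ _) _.
  rewrite ler_wpM2r ?wterm_ge0// /K -!(mulrA 4) -!(mulrA C).
  rewrite ler_wpM2l// ler_wpM2l// ler_pM ?expR_ge0// ler_expR ler_wpM2l//;
    exact: wnorm_coord.
have cK := summable_seqZ (r := K) wh.
have cb : summable_seq (fun k => breg k (t k) (h k)) by exact: summable_seq_le cK.
split=> //; apply: le_trans (ler_norm _) _.
by apply: le_trans (ssum_norm_le bK cK) _; rewrite ssumZ.
Qed.

Lemma summable_pot t : wl2 W t -> summable_seq (fun k => pot k (t k)).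
Proof.
move=> wt; have [cb _] := summable_breg (wl2_subspace W1).1 wt.
by move: cb; congr summable_seq; apply: funext => k; rewrite pot_breg.
Qed.

Lemma grad_dual t : wl2 W t ->
  summable_seq (fun k => grad k (t k) ^+ 2 / W k).
Proof.
move=> wt; pose K := 4 * C * expR (2 * wnorm W t).
apply: (summable_seq_le _ (summable_seqZ (r := K ^+ 2) wt)) => k.
rewrite ger0_norm ?divr_ge0 ?sqr_ge0 ?(ltW (W0 k))//.
rewrite ler_pdivrMr//.
rewrite (_ : _ * W k = (K * (W k * `|t k|)) ^+ 2); last by ring.
have K0 : 0 <= K by rewrite !mulr_ge0// expR_ge0.
have Wt : 0 <= W k * `|t k| by rewrite mulr_ge0// ltW.
rewrite -[leLHS]real_normK ?num_real// ler_sqr ?nnegrE ?mulr_ge0 ?(ltW (W0 k))//.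
apply: le_trans (grad_le _ _) _; rewrite ler_wpM2r// /K ler_wpM2l ?mulr_ge0//.
by rewrite ler_expR ler_wpM2l// wnorm_coord.
Qed.

(** * Minimization on a closed subspace whose norm is controlled by the coordinates in [G] *)

Variables (G : pred nat) (c D M : R) (N : set (nat -> R)).
Variable l : (nat -> R) -> R.
Hypothesis c0 : 0 < c.
Hypothesis ABc : forall k, G k -> c * W k <= A k /\ c * W k <= B k.
Hypothesis D0 : 0 < D.
Hypothesis sN : subspace N.
Hypothesis Nwl : N `<=` wl2 W.
Hypothesis N_closed : forall (T : nat -> nat -> R) t, (forall m, N (T m)) ->
  wl2 W t -> wsq W (fun k => T m k - t k) @[m --> \oo] --> (0 : R) -> N t.
Hypothesis N_coercive : forall t, N t ->
  wsq W t <= D * limn (series (fun k => if G k then W k * `|t k| ^+ 2 else 0)).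
Hypothesis l_linear : linear_on (V := R) N l.
Hypothesis l_bounded : forall t, N t -> `|l t| <= M * wnorm W t.

Definition energy t : R := limn (series (fun k => pot k (t k))) + l t.

Definition denergy t h : R := limn (series (fun k => grad k (t k) * h k)) + l h.

Lemma denergy_linear t : N t -> linear_on (V := R) N (denergy t).
Proof.
move=> Nt a s h Ns Nh; rewrite /denergy (l_linear a Ns Nh).
rewrite (dual_linear W1 (grad_dual (Nwl Nt)) a (Nwl Ns) (Nwl Nh)).
by rewrite scalerDr; lra.
Qed.

Lemma denergy_bounded t : N t ->
  exists K, forall h, N h -> `|denergy t h| <= K * wnorm W h.
Proof.
move=> Nt; have [K hK] := dual_bounded W1 (grad_dual (Nwl Nt)).
exists (K + M) => h Nh; apply: le_trans (ler_normD _ _) _.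
by rewrite mulrDl lerD ?hK ?l_bounded//; exact: Nwl.
Qed.

Lemma energy_add t h : N t -> N h -> energy (fun k => t k + h k) =
  energy t + denergy t h + limn (series (fun k => breg k (t k) (h k))).
Proof.
move=> Nt Nh; have wt := Nwl Nt; have wh := Nwl Nh.
have cp := summable_pot wt; have [cb _] := summable_breg wt wh.
have [cg _] := dual_summable W1 (grad_dual wt) wh.
rewrite /energy /denergy (linear_onD l_linear Nt Nh).
rewrite (_ : (fun k => pot k _) = fun k =>
    (pot k (t k) + grad k (t k) * h k) + breg k (t k) (h k)); last first.
  by apply: funext => k; rewrite pot_add.
rewrite ssumD ?ssumD//; first lra.
exact: summable_seqD.
Qed.

Lemma energy_tangent t s : N t -> N s ->
  energy t + denergy t (fun k => s k - t k) <= energy s.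
Proof.
move=> Nt Ns; have Nh := subspaceB sN Ns Nt.
have := energy_add Nt Nh; rewrite (_ : (fun k => _ + _) = s); last first.
  by apply: funext => k; rewrite addrC subrK.
move=> ->; rewrite lerDl; apply: ssum_ge0 => [k|]; first exact: breg_ge0.
by have [] := summable_breg (Nwl Nt) (Nwl Nh).
Qed.

(** Expand at the midpoint in the directions [h] and [-h], where [h = (t - s) / 2]: the linear terms
    cancel and two remainders are left. Together they are at least [c] times the weighted square of
    [h] over [G], hence [c / D] times that of [h]; the 4 comes from halving [t - s]. *)
Lemma energy_midpoint t s : N t -> N s ->
  c / (4 * D) * wsq W (fun k => t k - s k) <=
    energy t + energy s - 2 * energy (fun k => 2^-1 * (t k + s k)).
Proof.
move=> Nt Ns; pose m k := 2^-1 * (t k + s k); pose h k := 2^-1 * (t k - s k).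
have Nm : N m by apply: subspaceZ => //; exact: subspaceD.
have Nd : N (fun k => t k - s k) by exact: subspaceB.
have Nh : N h by exact: subspaceZ.
pose h' k := -1 * h k.
have Nh' : N h' by exact: subspaceZ.
have := energy_add Nm Nh; have := energy_add Nm Nh'.
rewrite (linear_onZ (V := R) (-1) sN (denergy_linear Nm) Nh) scaleN1r.
rewrite (_ : (fun k => m k + h' k) = s); last first.
  by apply: funext => k; rewrite /m /h' /h; field.
rewrite (_ : (fun k => m k + h k) = t); last first.
  by apply: funext => k; rewrite /m /h; field.
move=> -> ->; rewrite -/m.
have [cb _] := summable_breg (Nwl Nm) (Nwl Nh).
have [cb' _] := summable_breg (Nwl Nm) (Nwl Nh').
set b := limn (series (fun k => breg k (m k) (h k))).
set b' := limn (series (fun k => breg k (m k) (h' k))).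
suff : c / D * wsq W h <= b + b'.
  rewrite (wsqZ _ (Nwl Nd)) => H.
  have -> : c / (4 * D) * wsq W (fun k => t k - s k) =
    c / D * (2^-1 ^+ 2 * wsq W (fun k => t k - s k)) by field; rewrite gt_eqF.
  lra.
have sG : summable_seq (fun k => if G k then W k * `|h k| ^+ 2 else 0).
  apply: (summable_seq_le _ (Nwl Nh)) => k; case: ifP => _.
    by rewrite ger0_norm ?wterm_ge0.
  by rewrite normr0 wterm_ge0.
have := N_coercive Nh; rewrite -ler_pdivrMl// => H.
rewrite -ssumD//.
apply: (@le_trans _ _ (c * limn (series (fun k => if G k then W k * `|h k| ^+ 2 else 0)))).
  by rewrite -mulrA ler_wpM2l// ltW.
rewrite -ssumZ//.
apply: lim_series_le; [exact: summable_seqZ|exact: summable_seqD|move=> k /=].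
case: ifPn => [/ABc[cA cB]|_]; last first.
  by rewrite mulr0 addr_ge0// breg_ge0.
by rewrite /h' mulN1r; apply: breg_coercive => //; exact: ltW.
Qed.

Lemma energy_ge t : N t -> - (M ^+ 2 * D / (2 * c)) <= energy t.
Proof.
move=> Nt; have wt := Nwl Nt; have cp := summable_pot wt.
have sG : summable_seq (fun k => if G k then W k * `|t k| ^+ 2 else 0).
  apply: (summable_seq_le _ wt) => k; case: ifP => _.
    by rewrite ger0_norm ?wterm_ge0.
  by rewrite normr0 wterm_ge0.
have := N_coercive Nt.
have h1 : c / 2 * limn (series (fun k => if G k then W k * `|t k| ^+ 2 else 0))
    <= limn (series (fun k => pot k (t k))).
  rewrite -ssumZ//.
  apply: lim_series_le => //; first exact: summable_seqZ.
  move=> k /=; case: ifPn => [/ABc[cA cB]|_]; last first.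
    by rewrite mulr0 pot_breg breg_ge0.
  rewrite real_normK ?num_real// /pot.
  have ez := expR_rem_coercive (2 * t k).
  have e1 := expR_rem_ge0 (2 * t k); have e2 := expR_rem_ge0 (- (2 * t k)).
  have := ler_wpM2r e2 cA; have := ler_wpM2r e1 cB.
  have cW : 0 <= c * W k by rewrite mulr_ge0 ?ltW.
  have := ler_wpM2l cW ez; lra.
rewrite -ler_pdivrMl// -(wnorm_sqr W1 wt) => h2.
have := l_bounded Nt; rewrite ler_norml => /andP[h3 _].
rewrite /energy; set q := wnorm W t in h2 h3.
have h4 : c / 2 * (D^-1 * q ^+ 2) <= limn (series (fun k => pot k (t k))).
  by apply: le_trans h1; rewrite ler_wpM2l// divr_ge0// ltW.
(* Completes the square in [c q^2 / (2 D) - M q], whose minimum, at [q = M D / c], is the claimed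
   bound. *)
have : 0 <= c / (2 * D) * (q - M * D / c) ^+ 2.
  by rewrite mulr_ge0 ?sqr_ge0// divr_ge0 ?mulr_ge0// ltW.
have -> : c / (2 * D) * (q - M * D / c) ^+ 2 =
    c / 2 * (D^-1 * q ^+ 2) - M * q + M ^+ 2 * D / (2 * c).
  by field; rewrite !gt_eqF.
lra.
Qed.

Lemma energy_minimizer : exists2 t, N t & forall s, N s -> energy t <= energy s.
Proof.
pose E := [set energy t | t in N].
have lE : lbound E (- (M ^+ 2 * D / (2 * c))).
  by move=> _ [t Nt <-]; exact: energy_ge.
have iE : has_inf E.
  split; last by exists (- (M ^+ 2 * D / (2 * c))).
  by exists (energy (fun=> 0)), (fun=> 0); first exact: sN.1.
have infE s : N s -> inf E <= energy s.
  by move=> Ns; apply: (inf_lbound iE.2); exists s.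
have /choice[T TP] : forall m, exists t, N t /\ energy t < inf E + harmonic m.
  move=> m; have hm : 0 < harmonic m :> R by rewrite /= invr_gt0 ltr0n.
  by have [_ [t Nt <-] tm] := inf_adherent hm iE; exists t.
(* The inverse of the constant in [energy_midpoint]: points with energies within [1 / (m + 1)] and
   [1 / (p + 1)] of the infimum have squared distance at most [K] times the sum of these. *)
pose K := 4 * D / c.
have K0 : 0 < K by rewrite divr_gt0 ?mulr_gt0.
have rc : K * harmonic m @[m --> \oo] --> (0 : R).
  by rewrite -[0](mulr0 K); apply: cvgMr; exact: cvg_harmonic.
have Tcauchy m p : wsq W (fun k => T m k - T p k) <= K * harmonic m + K * harmonic p.
  have [[Nm Em] [Np Ep]] := (TP m, TP p).
  have := energy_midpoint Nm Np.
  have := infE _ (subspaceZ 2^-1 sN (subspaceD sN Nm Np)).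
  set e := energy (fun k => _) => h1 h2.
  rewrite -mulrDr -ler_pdivrMl//.
  have -> : K^-1 = c / (4 * D) by rewrite /K; field; rewrite !gt_eqF.
  apply: le_trans h2 _; lra.
have [t wt tlim] := wl2_complete W1 rc (fun m => Nwl (TP m).1) Tcauchy.
have wTt m : wl2 W (fun k => T m k - t k).
  by apply: (subspaceB (wl2_subspace W1)) => //; apply/Nwl/(TP m).1.
have Nt : N t.
  apply: (N_closed (fun m => (TP m).1) wt).
  apply: (squeeze_cvgr _ (cvg_cst 0) rc); apply: nearW => m.
  by rewrite wsq_ge0//=.
exists t => // s Ns; apply: le_trans (infE _ Ns).
have [L hL] := denergy_bounded Nt.
(* The tangent inequality at the limit [t] bounds [energy t] by [energy (T m)] plus [|L|] times the
   distance; this provides lower semicontinuity along the sequence. *)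
have bnd m : energy t <= inf E + (harmonic m + `|L| * Num.sqrt (K * harmonic m)).
  have [Nm Em] := TP m.
  have := energy_tangent Nt Nm; have := hL _ (subspaceB sN Nm Nt).
  rewrite ler_norml => /andP[h _] h'.
  have : L * wnorm W (fun k => T m k - t k) <= `|L| * Num.sqrt (K * harmonic m).
    apply: (@le_trans _ _ (`|L| * wnorm W (fun k => T m k - t k))).
      by rewrite ler_wpM2r ?wnorm_ge0// ler_norm.
    by rewrite ler_wpM2l// ler_wsqrtr.
  lra.
have lim0 : (inf E + (harmonic m + `|L| * Num.sqrt (K * harmonic m)) : R^o)
    @[m --> \oo] --> (inf E + (0 + `|L| * Num.sqrt 0) : R^o).
  apply: cvgD; first exact: cvg_cst.
  apply: cvgD; first exact: cvg_harmonic.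
  apply: cvgMr; apply: continuous_cvg rc; exact: sqrt_continuous.
rewrite sqrtr0 mulr0 !addr0 in lim0.
apply: (ler_cvg_to (cvg_cst (energy t : R^o)) lim0).
exact: nearW.
Qed.

Lemma minimizer_critical t : N t -> (forall s, N s -> energy t <= energy s) ->
  forall s, N s -> denergy t s = 0.
Proof.
move=> Nt tmin s Ns; set X := denergy t s.
have wt := Nwl Nt; have ws := Nwl Ns.
pose Y := 4 * C * expR (2 * wnorm W t) * expR (2 * wnorm W s) * wsq W s.
have Y0 : 0 <= Y by rewrite !mulr_ge0 ?expR_ge0 ?wsq_ge0.
(* For [|e| <= 1] the remainder in the direction [e s] is at most [e^2 Y], with the same [Y] for all
   such [e]. *)
have H (e : R) : `|e| <= 1 -> 0 <= e * X + e ^+ 2 * Y.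
  move=> e1; have Nh : N (fun k => e * s k) by exact: subspaceZ.
  have := tmin _ (subspaceD sN Nt Nh); rewrite (energy_add Nt Nh).
  rewrite (linear_onZ (V := R) e sN (denergy_linear Nt) Ns) -/X.
  have [_] := summable_breg wt (Nwl Nh).
  rewrite (wsqZ _ ws) (wnormZ _ ws).
  set b := limn _ => hb h; rewrite -[e *: X]/(e * X) in h.
  suff : b <= e ^+ 2 * Y by lra.
  apply: le_trans hb _; rewrite mulrCA ler_wpM2l ?sqr_ge0//.
  rewrite /Y ler_wpM2r ?wsq_ge0// ler_wpM2l ?mulr_ge0 ?expR_ge0//.
  by rewrite ler_expR ler_wpM2l// ler_piMl ?wnorm_ge0.
(* Testing with [e = - X / d] gives [X^2 (Y - d) / d^2 >= 0], while [Y < d]; this [d] also ensures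
   [|e| <= 1]. *)
pose d := `|X| + Y + 1.
have d0 : 0 < d by rewrite /d; have := normr_ge0 X; lra.
have : `|- X / d| <= 1.
  rewrite normrM normrN normfV (gtr0_norm d0) ler_pdivrMr// mul1r /d; lra.
move=> /H; rewrite (_ : _ + _ = X ^+ 2 * ((Y - d) / d ^+ 2)); last first.
  by field; rewrite gt_eqF.
have n0 : (Y - d) / d ^+ 2 < 0.
  rewrite pmulr_llt0 ?invr_gt0 ?exprn_gt0// /d; have := normr_ge0 X; lra.
rewrite nmulr_lge0// => X2; apply/eqP; rewrite -sqrf_eq0 eq_le X2.
exact: sqr_ge0.
Qed.

(** The tangent inequalities at the two critical points make both energies at most that of the
    midpoint; strong convexity then forces their distance to be 0. *)
Lemma critical_unique t s : N t -> N s ->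
  (forall h, N h -> denergy t h = 0) -> (forall h, N h -> denergy s h = 0) ->
  t = s.
Proof.
move=> Nt Ns ct cs; have Nd := subspaceB sN Nt Ns.
pose m k := 2^-1 * (t k + s k).
have Nm : N m by apply: subspaceZ => //; exact: subspaceD.
have := energy_midpoint Nt Ns; rewrite -/m.
have := energy_tangent Nt Nm; rewrite ct; last exact: subspaceB.
have := energy_tangent Ns Nm; rewrite cs; last exact: subspaceB.
move=> h1 h2 h3.
have : c / (4 * D) * wsq W (fun k => t k - s k) <= 0 by lra.
rewrite pmulr_rle0 ?divr_gt0 ?mulr_gt0// => q0.
apply: funext => k; apply/eqP; rewrite -subr_eq0 -normr_eq0 -sqrf_eq0.
rewrite eq_le sqr_ge0 andbT; apply: le_trans q0.
apply: le_trans (wsq_coord W1 k (Nwl Nd)).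
by rewrite ler_peMl ?sqr_ge0.
Qed.

End DiagonalConvex.

(** * Finitely supported sequences *)

Section FiniteSupport.
Context {R : realType}.
Variable W : nat -> R.
Hypothesis W1 : forall k, 1 <= W k.
Implicit Types (t : nat -> R).

Lemma sum_finsupp (V : zmodType) (a : nat -> V) m N : (m <= N)%N ->
  (forall k, (m <= k)%N -> a k = 0) ->
  \sum_(0 <= k < N) a k = \sum_(0 <= k < m) a k.
Proof.
move=> mN a0; rewrite (big_cat_nat (leq0n m) mN)/= [X in _ + X]big_nat.
by rewrite [X in _ + X]big1 ?addr0// => k /andP[mk _]; exact: a0.
Qed.

Lemma cvg_series_finsupp (K : numFieldType) (V : normedModType K)
    (a : nat -> V) m : (forall k, (m <= k)%N -> a k = 0) ->
  series a @ \oo --> \sum_(0 <= k < m) a k.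
Proof.
move=> a0; apply: cvg_near_cst; exists m => // N /= mN.
exact: sum_finsupp.
Qed.

Lemma wl2_finsupp t m : (forall k, (m <= k)%N -> t k = 0) -> wl2 W t.
Proof.
move=> t0; apply/cvg_ex; eexists; apply: (@cvg_series_finsupp R R^o _ m).
by move=> k mk; rewrite t0// normr0 expr0n/= mulr0.
Qed.

Lemma linear_finsupp (V : lmodType R) (f : (nat -> R) -> V) (v : nat -> V) t m :
    linear_on (wl2 W) f -> (forall k, f (coord_vec k) = v k) ->
    (forall k, (m <= k)%N -> t k = 0) ->
  f t = \sum_(0 <= k < m) t k *: v k.
Proof.
move=> fL fv; elim: m t => [|m IHm] t t0.
  rewrite big_geq// (_ : t = fun=> 0); last by apply: funext => k; exact: t0.
  exact: linear_on0 (wl2_subspace W1) fL.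
pose s k := if k == m then 0 else t k.
have s0 k : (m <= k)%N -> s k = 0.
  by rewrite /s leq_eqVlt eq_sym; case: eqP => //= _; exact: t0.
have ce : wl2 W (coord_vec m).
  apply: (@wl2_finsupp _ m.+1) => k mk.
  by rewrite /coord_vec gtn_eqF.
have := fL (t m) _ _ ce (wl2_finsupp s0); rewrite (IHm s s0) fv.
rewrite big_nat_recr//= addrC => fE.
rewrite (_ : t = (fun k => t m * coord_vec m k + s k)).
  rewrite fE/= /s /coord_vec eqxx mulr1 addr0; congr (_ + _).
  apply: eq_big_nat => k /andP[_ km]; rewrite ltn_eqF// mulr0 add0r//.
apply: funext => k; rewrite /s /coord_vec.
by case: eqP => [->|_]; rewrite ?mulr1 ?addr0 ?mulr0 ?add0r.
Qed.

End FiniteSupport.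

(** * Linear independence of the normals of flats through a common point *)

Section AffineFlats.
Variables (F : fieldType) (n : nat) (v : nat -> 'rV[F]_n) (b : nat -> F).

Definition rows (L : seq nat) : 'M[F]_(size L, n) :=
  \matrix_(i < size L) v (nth 0%N L i).

Lemma row_rows L i : row i (rows L) = v (nth 0%N L i).
Proof. by apply/rowP => j; rewrite !mxE. Qed.

(* A dependent list of flats through a common point could be enlarged by
   transversal flats, keeping the dependency and a common point, until it has
   more than n members. *)
Lemma rows_free :
    (forall m (U : 'M[F]_(m, n)), (\rank U < n)%N ->
       exists k, ~~ (v k <= U)%MS) ->
    (forall f : 'I_n.+1 -> nat, injective f ->
       ~ exists a : 'cV[F]_n, forall i, (v (f i) *m a) 0 0 = b (f i)) ->
  forall L (a : 'cV[F]_n), uniq L -> (forall k, k \in L -> (v k *m a) 0 0 = b k) ->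
    row_free (rows L).
Proof.
move=> vspan vdisj L.
have [d] := ubnP (n.+1 - size L)%N; elim: d L => // d IHd L Ld a uL aL.
apply: contrapT => /negP; rewrite /row_free => rL.
have {}rL : (\rank (rows L) < size L)%N by rewrite ltn_neqAle rL rank_leq_row.
(* With more than [n] members, the first [n + 1] flats already share [a], which the hypothesis
   forbids. *)
have [nL|Ln] := ltnP n (size L).
  pose f (i : 'I_n.+1) := nth 0%N L i.
  have fi (i : 'I_n.+1) : (i < size L)%N by exact: leq_trans (ltn_ord i) nL.
  apply: (vdisj f) => [i j /eqP|]; first by rewrite nth_uniq// => /eqP/val_inj.
  by exists a => i; apply: aL; rewrite mem_nth.
have [k kL] := vspan _ _ (leq_trans rL Ln).
have kNL : k \notin L.
  apply: contra kL => kL; have ki : (index k L < size L)%N by rewrite index_mem.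
  by rewrite -(nth_index 0%N kL) -(row_rows (Ordinal ki)) row_sub.
move: (kL); rewrite submxE => /eqP nz.
have [j nzj] : exists j, (v k *m cokermx (rows L)) 0 j != 0.
  apply: contrapT => /forallNP z; apply: nz; apply/rowP => j; rewrite [RHS]mxE.
  by have /negP/negPn/eqP := z j.
(* The rows of [L] annihilate [c], but [v k] does not. Moving [a] along [c] keeps it on the flats of
   [L], and the coefficient in [a'] puts it on the flat of [k]. *)
pose c := col j (cokermx (rows L)).
have vc w : (w *m c) 0 0 = (w *m cokermx (rows L)) 0 j.
  by rewrite mxE [RHS]mxE; apply: eq_bigr => i _; rewrite [X in _ * X]mxE.
pose a' := a + ((b k - (v k *m a) 0 0) / (v k *m c) 0 0) *: c.
have a'E w : (w *m a') 0 0 =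
    (w *m a) 0 0 + (b k - (v k *m a) 0 0) / (v k *m c) 0 0 * (w *m c) 0 0.
  by rewrite /a' mulmxDr -scalemxAr mxE [X in _ + X]mxE.
have : row_free (rows (k :: L)).
  apply: (IHd _ _ a') => [||i]; rewrite /= ?kNL//.
    by move: Ld; rewrite subSS; case: (size L) Ln => [|s] Ln; lia.
  rewrite inE => /orP[/eqP->|iL]; rewrite a'E.
    by rewrite divfK ?vc// addrC subrK.
  have -> : (v i *m c) 0 0 = 0.
    have ki : (index i L < size L)%N by rewrite index_mem.
    rewrite vc -(nth_index 0%N iL) -(row_rows (Ordinal ki)) -row_mul.
    by rewrite mulmx_coker row0 mxE.
  by rewrite mulr0 addr0 aL.
rewrite /row_free => /eqP rkL.
(* The enlarged list would have rank [size L + 1], yet one row adds at most 1 to a rank below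
   [size L]. *)
have : (rows (k :: L) <= v k + rows L)%MS.
  apply/row_subP => -[[|i] iL]; rewrite row_rows/=; first exact: addsmxSl.
  have iL' : (i < size L)%N by [].
  apply: submx_trans (addsmxSr _ _).
  by rewrite -(row_rows (Ordinal iL')) row_sub.
move=> /mxrankS; rewrite rkL /= => /leq_trans/(_ (mxrank_adds_leqif _ _).1).
by move: (rank_leq_row (v k)) rL => /=; lia.
Qed.

End AffineFlats.

(** * Linear algebra of the rows [u_k] over the real and complex numbers *)

Section RealRows.
Context {R : realType}.
Variables (n : nat) (u : nat -> 'rV[int]_n).
Hypothesis u_span : spanning (R := R) u.

Local Notation toC := (real_complex R).

(** A right inverse [B] of [U] recovers [tau] from its image. The sum of the absolute entries of [B]
    serves as constant since row vectors carry the maximum norm. *)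
Lemma row_free_bound m (U : 'M[R]_(m, n)) : row_free U ->
  exists2 P : R, 0 <= P &
    forall (tau : 'rV_m) i, `|tau 0 i| <= P * `|tau *m U|.
Proof.
move=> /row_freeP[B UB]; exists (\sum_j \sum_i `|B j i|) => [|tau i].
  by apply: sumr_ge0 => j _; apply: sumr_ge0.
rewrite -[in leLHS](mulmx1 tau) -UB mulmxA mxE.
apply: le_trans (ler_norm_sum _ _ _) _; rewrite mulr_suml.
apply: ler_sum => j _; rewrite normrM mulrC ler_pM//.
  by rewrite (bigD1 i)//= lerDl sumr_ge0.
rewrite [leRHS]/Num.norm/= mx_normrE.
by apply: (@le_bigmax _ _ _ _ _ (0, j)).
Qed.

Lemma spanning_row_full :
  exists m, row_full (\matrix_(i < m) real_row (u i) : 'M[R]_(m, n)).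
Proof.
have /choice[m Hm] : forall j : 'I_n, exists m : nat, exists a : 'I_m -> R,
    delta_mx 0 j = \sum_(k < m) a k *: real_row (u k) by move=> j; exact: u_span.
exists (\max_j m j)%N; rewrite -sub1mx; apply/row_subP => j.
rewrite rowE mulmx1; have [a ->] := Hm j.
apply: summx_sub => k _; apply: scalemx_sub.
have km : (k < \max_j m j)%N by exact: leq_trans (ltn_ord k) (leq_bigmax j).
rewrite (_ : real_row _ = row (Ordinal km) (\matrix_(i < \max_j m j) real_row (u i))).
  exact: row_sub.
by apply/rowP => l; rewrite !mxE.
Qed.

Lemma map_real_row k : map_mx toC (real_row (u k)) = map_mx intr (u k).
Proof. by apply/matrixP => i j; rewrite !mxE rmorph_int. Qed.

(** Rank is unchanged by extension of scalars, so the real rows also span over the complex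
    numbers. *)
Lemma spanning_not_sub m (U : 'M[R[i]]_(m, n)) : (\rank U < n)%N ->
  exists k, ~~ (map_mx intr (u k) <= U)%MS.
Proof.
move=> rU; apply: contrapT => /forallNP H.
have [p full] := spanning_row_full.
have : (map_mx toC (\matrix_(i < p) real_row (u i)) <= U)%MS.
  apply/row_subP => i; have /negP/negPn := H i.
  congr (_ <= _)%MS; apply/rowP => j.
  by rewrite -map_real_row !mxE.
move=> /mxrankS; rewrite mxrank_map (eqP full) => nU.
by move: rU; rewrite ltnNge nU.
Qed.

(* The point a_C of the flats: linear relations among the u_k are relations
   among the prescribed values, so these extend to a functional on R^n. *)
Lemma functional_of_relations (f : nat -> R[i]) :
    (forall (t : nat -> R) m, (forall k, (m <= k)%N -> t k = 0) ->
       \sum_(0 <= k < m) t k *: real_row (u k) = 0 ->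
       \sum_(0 <= k < m) f k * (t k)%:C%C = 0) ->
  exists a : 'cV[R[i]]_n, forall k, (map_mx intr (u k) *m a) 0 0 = f k.
Proof.
move=> rel; have [m /row_fullP[V VU]] := spanning_row_full.
exists (map_mx toC V *m \col_i f i) => k.
(* Coefficients of [u_k] over the first [m] rows. Subtracting the coordinate vector of [k] gives the
   relation to which [rel] is applied. *)
pose r := real_row (u k) *m V.
pose w j : R := if insub j is Some i then r 0 i else 0.
have wE (i : 'I_m) : w i = r 0 i by rewrite /w valK.
have w0 j : (m <= j)%N -> w j = 0.
  by move=> mj; rewrite /w insubF// ltnNge mj.
(* The index [k] may lie beyond the first [m]. *)
pose M := maxn m k.+1.
have sumM (V0 : zmodType) (g : nat -> V0) : (forall j, (m <= j)%N -> g j = 0) ->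
    \sum_(0 <= j < M) g j = \sum_(i < m) g i.
  by move=> g0; rewrite (sum_finsupp (leq_maxl m k.+1) g0) big_mkord.
have sumk (V0 : zmodType) (g : nat -> V0) : (forall j, j != k -> g j = 0) ->
    \sum_(0 <= j < M) g j = g k.
  move=> g0; have kM : (k < M)%N by rewrite leq_max ltnSn orbT.
  rewrite big_mkord (bigD1 (Ordinal kM))//= big1 ?addr0// => i ik.
  by apply: g0; apply: contra ik => /eqP ik; apply/eqP/val_inj.
have := rel (fun j => w j - (j == k)%:R) M.
have -> : \sum_(0 <= j < M) (w j - (j == k)%:R) *: real_row (u j) = 0 :> 'rV[R]_n.
  under eq_bigr do rewrite scalerBl.
  rewrite sumrB sumM => [|j mj]; last by rewrite w0// scale0r.
  rewrite sumk => [|j /negPf->]; last by rewrite scale0r.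
  rewrite eqxx scale1r; apply/eqP; rewrite subr_eq0; apply/eqP.
  rewrite -[RHS]mulmx1 -VU mulmxA -/r mulmx_sum_row; apply: eq_bigr => i _.
  by rewrite wE; congr (_ *: _); apply/rowP => j; rewrite !mxE.
move=> relM.
have {relM}: \sum_(0 <= j < M) f j * (w j - (j == k)%:R)%:C%C = 0.
  apply: relM => // j; rewrite geq_max => /andP[mj kj].
  by rewrite w0// gtn_eqF// subr0.
under eq_bigr do rewrite rmorphB mulrBr.
rewrite sumrB sumM => [|j mj]; last by rewrite w0// rmorph0 mulr0.
rewrite sumk => [|j /negPf->]; last by rewrite rmorph0 mulr0.
rewrite eqxx rmorph1 mulr1 => /eqP; rewrite subr_eq0 => /eqP <-.
rewrite -map_real_row mulmxA -map_mxM -/r mxE; apply: eq_bigr => i _.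
by rewrite wE !mxE mulrC.
Qed.

End RealRows.

(** * Complex modulus and exponential *)

Section ComplexExponential.
Context {R : realType}.
Local Open Scope complex_scope.
Implicit Types (a b : R[i]) (t : R).

Lemma normc_real t : normc (t%:C) = `|t|.
Proof. by rewrite /normc/= expr0n/= addr0 sqrtr_sqr. Qed.

Lemma normc_ge0 a : 0 <= normc a.
Proof. by case: a => p q; rewrite /normc sqrtr_ge0. Qed.

Lemma normc_eq0 a : (normc a == 0) = (a == 0).
Proof.
by apply/eqP/eqP => [/eq0_normc//|->]; exact: normc0.
Qed.

Lemma normc_distC a b : normc (a - b) = normc (b - a).
Proof. by rewrite -normcN opprB. Qed.

Lemma normc_sqrD a b : normc (a + b) ^+ 2 <= 2 * normc a ^+ 2 + 2 * normc b ^+ 2.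
Proof.
apply: (@le_trans _ _ ((normc a + normc b) ^+ 2)).
  by rewrite ler_sqr ?nnegrE ?addr_ge0 ?normc_ge0// le_normcD.
by have := sqr_ge0 (normc a - normc b); lra.
Qed.

Lemma normc_dist_le a b : `|normc a - normc b| <= normc (a - b).
Proof.
rewrite ler_norml; apply/andP; split.
  rewrite normc_distC; have := le_normcD (b - a) a; rewrite subrK; lra.
by have := le_normcD (a - b) b; rewrite subrK; lra.
Qed.

Lemma expi0 : expi (0 : R[i]) = 1.
Proof. by rewrite /expi/= oppr0 expR0 cos0 sin0 mul1r. Qed.

Lemma expiD a b : expi (a + b) = expi a * expi b.
Proof.
case: a => a1 a2; case: b => b1 b2; rewrite /expi/= opprD expRD cosD sinD.
by apply/eqP; rewrite eq_complex/=; apply/andP; split; apply/eqP; ring.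
Qed.

Lemma expi_neq0 a : expi a != 0.
Proof.
apply/eqP => a0; have := expiD a (- a); rewrite subrr expi0 a0 mul0r.
by move/eqP; rewrite oner_eq0.
Qed.

Lemma expiN a : expi (- a) = (expi a)^-1.
Proof.
apply: (mulfI (expi_neq0 a)).
by rewrite -expiD subrr expi0 divff// expi_neq0.
Qed.

Lemma expi_imaginary t : expi ('i * t%:C) = (expR (- t))%:C.
Proof.
rewrite /expi; have -> : complex.Re ('i * t%:C) = 0.
  by rewrite /= !mul0r mulr0 subrr.
have -> : complex.Im ('i * t%:C) = t by rewrite /= mul0r mul1r add0r.
by rewrite cos0 sin0 mulr1.
Qed.

End ComplexExponential.

(** * Quaternion norm *)

Section QuaternionNorm.
Context {R : realType}.
Local Open Scope complex_scope.
Implicit Types x : quat R.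

Lemma qnorm_sqr x : qnorm x ^+ 2 = normc x.1 ^+ 2 + normc x.2 ^+ 2.
Proof. by rewrite sqr_sqrtr// addr_ge0// sqr_ge0. Qed.

Lemma qnormN x : qnorm (- x) = qnorm x.
Proof. by rewrite /qnorm /= !normcN. Qed.

Lemma qnorm_qhopf x : qnorm (qhopf x) = (normc x.1 ^+ 2 + normc x.2 ^+ 2) / 2.
Proof.
rewrite -[RHS]ger0_norm; last by rewrite divr_ge0// addr_ge0// sqr_ge0.
rewrite -sqrtr_sqr; congr Num.sqrt.
case: x => -[a b] [c d]; rewrite /qhopf /qscale /qmul /qconj /qi /normc /=.
rewrite !sqr_sqrtr ?addr_ge0 ?sqr_ge0//.
by field.
Qed.

End QuaternionNorm.

(** * The groups N and N^C and their action on M_Lambda *)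

Section TorusActions.
Context {R : realType}.
Variables (Lam : nat -> quat R) (n : nat) (beta : (nat -> R) -> 'rV[R]_n).
Local Open Scope complex_scope.
Implicit Types (x y : nat -> quat R) (g h : nat -> R[i]) (s t : nat -> R).

Local Notation W := (weight Lam).

Lemma weight_ge1 k : 1 <= W k.
Proof. by rewrite lerDl sqrtr_ge0. Qed.

Let W0 k : 0 < W k. Proof. exact: lt_le_trans (weight_ge1 k). Qed.

Lemma weightE k : W k = 1 + (normc (Lam k).1 ^+ 2 + normc (Lam k).2 ^+ 2) / 2.
Proof. by rewrite /weight /lambda qnormN qnorm_qhopf. Qed.

Lemma normc_Lam_le k :
  normc (Lam k).1 ^+ 2 <= 2 * W k /\ normc (Lam k).2 ^+ 2 <= 2 * W k.
Proof.
rewrite weightE; have := sqr_ge0 (normc (Lam k).1).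
have := sqr_ge0 (normc (Lam k).2); lra.
Qed.

Lemma M_Lam_dist x : M_Lam Lam x -> exists S, 0 <= S /\ forall k,
  normc ((x k).1 - (Lam k).1) ^+ 2 + normc ((x k).2 - (Lam k).2) ^+ 2 <= S.
Proof.
move=> Mx; exists (limn (series (fun k => qnorm (x k - Lam k) ^+ 2))).
have q0 k : 0 <= qnorm (x k - Lam k) ^+ 2 by exact: sqr_ge0.
split=> [|k]; first exact: ssum_ge0.
have := ssum_partial k.+1 q0 Mx; rewrite big_nat_recr//= qnorm_sqr.
by apply: le_trans; rewrite lerDr sumr_ge0.
Qed.

Lemma M_Lam_le x : M_Lam Lam x -> exists C, forall k,
  normc (x k).1 ^+ 2 <= C * W k /\ normc (x k).2 ^+ 2 <= C * W k.
Proof.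
move=> /M_Lam_dist[S [S0 Sx]]; exists (4 + 2 * S) => k.
have [L1 L2] := normc_Lam_le k; have := Sx k.
have := normc_sqrD ((x k).1 - (Lam k).1) (Lam k).1.
have := normc_sqrD ((x k).2 - (Lam k).2) (Lam k).2; rewrite !subrK.
have := sqr_ge0 (normc ((x k).1 - (Lam k).1)).
have := sqr_ge0 (normc ((x k).2 - (Lam k).2)).
have := ler_wpM2l S0 (weight_ge1 k); lra.
Qed.

(** As lambda cancels the value at Lambda, the coefficient is a difference of terms
    [(y^2 - c^2) / 2] with [y] from [x] and [c] from Lambda. In [y^2 - c^2 = (y - c) (y + c)] the
    first factor is square summable and the square of the second is [O(W)], so mu^R(x) is a bounded
    functional on [t_lam]. *)
Lemma muR_dual x : M_Lam Lam x ->
  summable_seq (fun k => imR (mu_coef Lam x k) ^+ 2 / W k).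
Proof.
move=> Mx; have [S [S0 Sx]] := M_Lam_dist Mx.
apply: (summable_seq_le _ (summable_seqZ (r := 8 + S) Mx)) => k.
rewrite ger0_norm ?divr_ge0 ?sqr_ge0 ?(ltW (W0 k))// ler_pdivrMr// qnorm_sqr.
rewrite imR_mu_coef.
have -> : imR (lambda Lam k) =
    - (2^-1 * (normc (Lam k).1 ^+ 2 - normc (Lam k).2 ^+ 2)).
  by rewrite -imR_qhopf /lambda /imR /= raddfN.
have [L1 L2] := normc_Lam_le k; have := Sx k.
have := normc_dist_le (x k).1 (Lam k).1; have := normc_dist_le (x k).2 (Lam k).2.
have := normc_ge0 ((x k).1 - (Lam k).1).
have := normc_ge0 ((x k).2 - (Lam k).2).
rewrite /=.
set z := normc (x k).1; set w := normc (x k).2.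
set a := normc (Lam k).1 in L1 *; set b := normc (Lam k).2 in L2 *.
set p := normc ((x k).1 - _); set q := normc ((x k).2 - _).
move=> q0 p0 hw hz hS.
(* Here [(y + c)^2 <= 2 (y - c)^2 + 8 c^2 <= 2 S + 16 W], and [W >= 1] absorbs [S] into the
   weight. *)
have key (y c r : R) : 0 <= r -> `|y - c| <= r -> c ^+ 2 <= 2 * W k ->
    r ^+ 2 <= S -> (y ^+ 2 - c ^+ 2) ^+ 2 <= r ^+ 2 * ((16 + 2 * S) * W k).
  move=> r0 yc cW rS.
  rewrite subr_sqr exprMn; apply: ler_pM; rewrite ?sqr_ge0//.
    by rewrite -real_normK ?num_real// ler_sqr ?nnegrE.
  have yc2 : (y - c) ^+ 2 <= S.
    by apply: le_trans rS; rewrite -real_normK ?num_real// ler_sqr ?nnegrE.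
  have -> : y + c = (y - c) + 2 * c by ring.
  have := sqr_ge0 ((y - c) - 2 * c).
  have := ler_wpM2l S0 (weight_ge1 k); nra.
have hp : p ^+ 2 <= S by have := sqr_ge0 q; lra.
have hq : q ^+ 2 <= S by have := sqr_ge0 p; lra.
have := key z a p p0 hz L1 hp; have := key w b q q0 hw L2 hq.
have := sqr_ge0 ((z ^+ 2 - a ^+ 2) + (w ^+ 2 - b ^+ 2)).
nra.
Qed.

Lemma actM g h x : act (fun k => g k * h k) x = act g (act h x).
Proof. by apply: funext => k; rewrite /act/= invfM !mulrA. Qed.

Lemma act1 x : act (fun=> 1) x = x.
Proof. by apply: funext => k; rewrite /act/= invr1 !mul1r; case: (x k). Qed.

(** Write [h z - Lambda_z = (h - 1) z + (z - Lambda_z)] with [|z|^2 <= C W], and likewise for [w],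
    on which the inverse of [h] acts. *)
Lemma act_M_Lam h x :
  summable_seq (fun k => W k * normc (1 - h k) ^+ 2) ->
  summable_seq (fun k => W k * normc (1 - (h k)^-1) ^+ 2) ->
  M_Lam Lam x -> M_Lam Lam (act h x).
Proof.
move=> h1 h2 Mx; have [C Cx] := M_Lam_le Mx.
have b := summable_seqD (summable_seqZ (r := 2 * C) (summable_seqD h1 h2))
  (summable_seqZ (r := 2) Mx).
apply: (summable_seq_le _ b) => k.
rewrite ger0_norm ?sqr_ge0// !qnorm_sqr /=.
have [z w] := Cx k.
have key (a e c : R[i]) : normc a ^+ 2 <= C * W k ->
    normc (e * a - c) ^+ 2 <=
    2 * (C * W k * normc (1 - e) ^+ 2) + 2 * normc (a - c) ^+ 2.
  move=> aC; have -> : e * a - c = - ((1 - e) * a) + (a - c) by ring.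
  apply: le_trans (normc_sqrD _ _) _; rewrite normcN normcM exprMn.
  by rewrite lerD2r ler_pM2l// [leLHS]mulrC; apply: ler_wpM2r; rewrite ?sqr_ge0.
have := key _ (h k) (Lam k).1 z; have := key _ (h k)^-1 (Lam k).2 w; lra.
Qed.

Lemma T_lam1 : T_lam Lam (fun=> 1).
Proof.
split=> [k|]; first exact: normc1.
apply/cvg_ex; eexists; apply: (@cvg_series_finsupp R R^o _ 0) => k _.
by rewrite subrr normc0 expr0n mulr0.
Qed.

Lemma T_lamM g h : T_lam Lam g -> T_lam Lam h -> T_lam Lam (fun k => g k * h k).
Proof.
move=> [g1 gs] [h1 hs]; split=> [k|]; first by rewrite normcM g1 h1 mulr1.
apply: (summable_seq_le _ (summable_seqZ (r := 2) (summable_seqD gs hs))) => k.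
rewrite ger0_norm; last by rewrite mulr_ge0 ?sqr_ge0 ?(ltW (W0 k)).
rewrite -[X in 2 * X]mulrDr [leRHS]mulrCA ler_pM2l ?W0//.
have -> : 1 - g k * h k = (1 - g k) + g k * (1 - h k) by ring.
by apply: le_trans (normc_sqrD _ _) _; rewrite normcM g1 mul1r mulrDr.
Qed.

Lemma T_lam_neq0 g k : T_lam Lam g -> g k != 0.
Proof. by move=> [g1 _]; rewrite -normc_eq0 g1 oner_eq0. Qed.

Lemma T_lamV g : T_lam Lam g -> T_lam Lam (fun k => (g k)^-1).
Proof.
move=> Tg; have [g1 gs] := Tg; split=> [k|]; first by rewrite normcV g1 invr1.
move: gs; congr summable_seq; apply: funext => k.
have -> : 1 - (g k)^-1 = - ((g k)^-1 * (1 - g k)).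
  by rewrite mulrBr mulVf ?(T_lam_neq0 k Tg)//; ring.
by rewrite normcN normcM normcV g1 invr1 mul1r.
Qed.

Hypothesis beta_linear : linear_on (t_lam Lam) beta.

Let st : subspace (t_lam Lam). Proof. exact: (wl2_subspace weight_ge1). Qed.

Lemma lie_N_subspace : subspace (lie_N Lam beta).
Proof.
split; first by split; [exact: st.1|exact: (linear_on0 st beta_linear)].
move=> a s t [ts bs] [tt bt]; split; first exact: st.2.
by rewrite beta_linear// bs bt scaler0 addr0.
Qed.

Lemma texpD (a b : nat -> R[i]) :
  texp (fun k => a k + b k) = fun k => texp a k * texp b k.
Proof. by apply: funext => k; exact: expiD. Qed.

Lemma grp_N1 : grp_N Lam beta (fun=> 1).
Proof.
split; first exact: T_lam1.
exists (fun=> 0); split => [||i]; first exact: st.1.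
  by apply: funext => k; rewrite /texp rmorph0 expi0.
by rewrite (linear_on0 st beta_linear) mxE rmorph0 expi0.
Qed.

Lemma grp_NM g h : grp_N Lam beta g -> grp_N Lam beta h ->
  grp_N Lam beta (fun k => g k * h k).
Proof.
move=> [Tg [s [ts sg bs]]] [Th [t [tt th bt]]]; split; first exact: T_lamM.
exists (fun k => s k + t k); split => [||i]; first exact: (subspaceD st).
  by rewrite -sg -th -texpD; congr texp; apply: funext => k; rewrite rmorphD.
by rewrite (linear_onD beta_linear)// mxE rmorphD/= expiD bs bt mulr1.
Qed.

Lemma grp_NV g : grp_N Lam beta g -> grp_N Lam beta (fun k => (g k)^-1).
Proof.
move=> [Tg [t [tt tg bt]]]; split; first exact: T_lamV.
exists (fun k => -1 * t k); split => [||i]; first exact: (subspaceZ _ st).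
  by rewrite -tg; apply: funext => k; rewrite /texp mulN1r rmorphN expiN.
by rewrite (linear_onZ _ st beta_linear)// scaleN1r mxE rmorphN/= expiN bt invr1.
Qed.

Lemma grp_N_T g : grp_N Lam beta g -> T_lam Lam g.
Proof. by case. Qed.

Definition iexp t : nat -> R[i] := texp (fun j => 'i * (t j)%:C).

Lemma iexpE t k : iexp t k = (expR (- t k))%:C.
Proof. exact: expi_imaginary. Qed.

Lemma iexpD s t : iexp (fun k => s k + t k) = fun k => iexp s k * iexp t k.
Proof. by rewrite -texpD; congr texp; apply: funext => k; rewrite rmorphD mulrDr. Qed.

Lemma iexp0 : iexp (fun=> 0) = fun=> 1.
Proof. by apply: funext => k; rewrite iexpE oppr0 expR0. Qed.

Lemma iexpN t k : iexp (fun k => -1 * t k) k = (iexp t k)^-1.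
Proof. by rewrite /iexp /texp -expiN mulN1r rmorphN mulrN. Qed.

Lemma iexp_neq0 t k : iexp t k != 0.
Proof. exact: expi_neq0. Qed.

Lemma grp_NC_intro g t : grp_N Lam beta g -> lie_N Lam beta t ->
  grp_NC Lam beta (fun k => g k * iexp t k).
Proof. by move=> Ng nt; exists g, t. Qed.

Lemma grp_NC_sub g : grp_N Lam beta g -> grp_NC Lam beta g.
Proof.
move=> Ng; have := grp_NC_intro Ng lie_N_subspace.1; rewrite iexp0.
by congr grp_NC; apply: funext => k; rewrite mulr1.
Qed.

Lemma grp_NC_iexp t : lie_N Lam beta t -> grp_NC Lam beta (iexp t).
Proof.
move=> Nt; have := grp_NC_intro grp_N1 Nt.
by congr grp_NC; apply: funext => k; rewrite mul1r.
Qed.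

Lemma grp_NCM g h : grp_NC Lam beta g -> grp_NC Lam beta h ->
  grp_NC Lam beta (fun k => g k * h k).
Proof.
move=> [g' [s [Ng ns ->]]] [h' [t [Nh nt ->]]].
have := grp_NC_intro (grp_NM Ng Nh) (subspaceD lie_N_subspace ns nt).
by rewrite iexpD; congr grp_NC; apply: funext => k; rewrite mulrACA.
Qed.

Lemma grp_NCV g : grp_NC Lam beta g -> grp_NC Lam beta (fun k => (g k)^-1).
Proof.
move=> [g' [s [Ng ns ->]]].
have := grp_NC_intro (grp_NV Ng) (subspaceZ (-1) lie_N_subspace ns).
by congr grp_NC; apply: funext => k; rewrite iexpN [RHS]invfM.
Qed.

Lemma grp_NC_neq0 g k : grp_NC Lam beta g -> g k != 0.
Proof.
move=> [g' [s [Ng ns ->]]]; rewrite mulf_neq0 ?iexp_neq0//.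
by rewrite (T_lam_neq0 _ (grp_N_T Ng)).
Qed.

Lemma actK g x : (forall k, g k != 0) -> act (fun k => (g k)^-1) (act g x) = x.
Proof.
move=> g0; rewrite -actM -[RHS]act1; congr act.
by apply: funext => k; rewrite mulVf.
Qed.

Lemma orbit_N_refl x : orbit_of (grp_N Lam beta) x x.
Proof. by exists (fun=> 1); [exact: grp_N1|exact: act1]. Qed.

Lemma orbit_N_eq x y : orbit_of (grp_N Lam beta) x y ->
  orbit_of (grp_N Lam beta) y = orbit_of (grp_N Lam beta) x.
Proof.
move=> [g Ng <-]; apply/seteqP; split=> _ [h Nh <-].
  by exists (fun k => h k * g k); [exact: grp_NM|rewrite actM].
exists (fun k => h k * (g k)^-1); first by apply: grp_NM => //; exact: grp_NV.
by rewrite actM actK// => k; exact: T_lam_neq0 (grp_N_T Ng).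
Qed.

Lemma orbit_NC_eq x y : orbit_of (grp_NC Lam beta) x y ->
  orbit_of (grp_NC Lam beta) y = orbit_of (grp_NC Lam beta) x.
Proof.
move=> [g Ng <-]; apply/seteqP; split=> _ [h Nh <-].
  by exists (fun k => h k * g k); [exact: grp_NCM|rewrite actM].
exists (fun k => h k * (g k)^-1); first by apply: grp_NCM => //; exact: grp_NCV.
by rewrite actM actK// => k; exact: grp_NC_neq0 Ng.
Qed.

Lemma orbit_N_NC x y :
  orbit_of (grp_N Lam beta) x y -> orbit_of (grp_NC Lam beta) x y.
Proof. by move=> [g Ng <-]; exists g => //; exact: grp_NC_sub. Qed.

Lemma iexp_summable t : t_lam Lam t ->
  summable_seq (fun k => W k * normc (1 - iexp t k) ^+ 2).
Proof.
move=> tt; pose K := expR (wnorm W t) ^+ 2.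
apply: (summable_seq_le _ (summable_seqZ (r := K) tt)) => k.
rewrite ger0_norm; last by rewrite mulr_ge0 ?sqr_ge0 ?(ltW (W0 k)).
rewrite [leRHS]mulrCA ler_pM2l ?W0// /K -exprMn iexpE.
rewrite -(rmorph1 (real_complex R)) -rmorphB normc_real.
rewrite ler_sqr ?nnegrE ?mulr_ge0 ?expR_ge0// distrC.
apply: le_trans (expR_sub1_le _) _; rewrite normrN mulrC ler_wpM2r//.
by rewrite ler_expR (wnorm_coord weight_ge1).
Qed.

Lemma act_iexp_M_Lam t x : t_lam Lam t -> M_Lam Lam x -> M_Lam Lam (act (iexp t) x).
Proof.
move=> tt Mx; apply: (act_M_Lam (iexp_summable tt) _ Mx).
rewrite (_ : (fun k => _) = fun k => W k * normc (1 - iexp (fun j => -1 * t j) k) ^+ 2).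
  exact: iexp_summable (subspaceZ (-1) st tt).
by apply: funext => k; rewrite iexpN.
Qed.

Lemma act_T_M_Lam g x : T_lam Lam g -> M_Lam Lam x -> M_Lam Lam (act g x).
Proof.
by move=> Tg; exact: act_M_Lam Tg.2 (T_lamV Tg).2.
Qed.

Lemma act_NC_M_Lam g x : grp_NC Lam beta g -> M_Lam Lam x -> M_Lam Lam (act g x).
Proof.
move=> [g' [t [[Tg _] [tt _] ->]]] Mx; rewrite actM.
by apply: act_T_M_Lam => //; exact: act_iexp_M_Lam.
Qed.

Lemma imC_mu_act g x k : g k != 0 ->
  imC (mu_coef Lam (act g x) k) = imC (mu_coef Lam x k).
Proof. by move=> g0; rewrite !imC_mu_coef /act/= mulrACA divff// mul1r. Qed.

Lemma muC_zero_act g x : grp_NC Lam beta g ->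
  muC_zero Lam beta x -> muC_zero Lam beta (act g x).
Proof.
move=> Ng [Mx mux]; split=> [|t /mux <-]; first exact: act_NC_M_Lam.
apply: (f_equal (fun a : nat -> R[i]^o => limn (series a))).
apply: funext => k.
by rewrite imC_mu_act// (grp_NC_neq0 _ Ng).
Qed.

Lemma muR_level_act g x c : grp_N Lam beta g ->
  muR_level Lam beta c x -> muR_level Lam beta c (act g x).
Proof.
move=> [Tg _] [Mx mux]; split=> [|t /mux <-]; first exact: act_T_M_Lam.
rewrite /muR; congr (limn (series _)); apply: funext => k.
by rewrite !imR_mu_coef /act/= !normcM normcV Tg.1 invr1 !mul1r.
Qed.

Definition moment1 x k := normc (x k).1 ^+ 2 / 2.
Definition moment2 x k := normc (x k).2 ^+ 2 / 2.

(** exp(i t) multiplies [|z_k|^2] by [e^(-2 t_k)] and [|w_k|^2] by [e^(2 t_k)]. This identifies the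
    variation of mu^R with the gradient of a diagonal convex function. *)
Lemma imR_mu_iexp t x k : imR (mu_coef Lam (act (iexp t) x) k) =
  imR (mu_coef Lam x k) - grad (moment1 x) (moment2 x) k (t k).
Proof.
rewrite !imR_mu_coef /act/= iexpE !normcM normcV normc_real.
rewrite gtr0_norm ?expR_gt0// -expRN opprK /grad /moment1 /moment2.
have -> : - (2 * t k) = - t k + - t k by ring.
have -> : 2 * t k = t k + t k by ring.
by rewrite !expRD; field.
Qed.

End TorusActions.

(** * Bounds on the moments and coercivity on the Lie algebra of N *)

Section MomentMap.
Context {R : realType}.
Variables (n : nat) (u : nat -> 'rV[int]_n).
Variables (Lam : nat -> quat R) (beta : (nat -> R) -> 'rV[R]_n).
Local Open Scope complex_scope.
Implicit Types (x y : nat -> quat R) (s t : nat -> R).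

Local Notation W := (weight Lam).
Local Notation W1 := (weight_ge1 Lam).

Let W0 k : 0 < W k. Proof. exact: lt_le_trans (W1 k). Qed.

Let st : subspace (t_lam Lam). Proof. exact: (wl2_subspace W1). Qed.

Lemma bounded_of_continuous (V : normedModType R) A (f : (nat -> R) -> V) :
    subspace A -> A `<=` t_lam Lam -> linear_on A f -> continuous_on Lam A f ->
  exists M, forall t, A t -> `|f t| <= M * wnorm W t.
Proof.
move=> sA Awl fL fC; have [d d0 Hd] := fC _ sA.1 _ ltr01.
exists (1 / d). apply: (linear_bounded sA Awl fL d0) => t At td.
rewrite -[f t]subr0 -(linear_on0 sA fL); apply/ltW/Hd => //.
by apply: le_lt_trans td; rewrite /t_norm; under eq_fun do rewrite subr0.
Qed.

Lemma weight_unbounded (T : R) :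
  summable_seq (fun k => (1 + qnorm (lambda Lam k))^-1) ->
  \forall k \near \oo, T <= W k.
Proof.
move=> /cvg_series_cvg_0 /cvgrPdist_lt cv.
have e0 : 0 < (`|T| + 1)^-1 by rewrite invr_gt0 ltr_wpDl.
have [K _ HK] := cv _ e0; exists K => // k /= Kk.
have := HK k Kk; rewrite -/(W k) sub0r normrN gtr0_norm ?invr_gt0 ?W0//.
have T1 : 0 < `|T| + 1 by rewrite ltr_wpDl.
rewrite ltf_pV2 ?posrE ?W0//.
by have := ler_norm T; lra.
Qed.

(** Balancedness makes each of [|Lambda_z|^2] and [|Lambda_w|^2] at least the fraction [a] of their
    sum [2 (W - 1)]. The point [x] differs from Lambda by a bounded amount, negligible once [W] is
    large. *)
Lemma moment_ge_near x :
    summable_seq (fun k => (1 + qnorm (lambda Lam k))^-1) ->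
    (exists C1 C2 : R, [/\ 0 < C1, 0 < C2 & \forall k \near \oo,
       C1 * normc (Lam k).2 <= normc (Lam k).1 <= C2 * normc (Lam k).2]) ->
    M_Lam Lam x ->
  exists2 c : R, 0 < c & \forall k \near \oo,
    c * W k <= moment1 x k /\ c * W k <= moment2 x k.
Proof.
move=> lamS [C1 [C2 [C1p C2p bal]]] Mx; have [S [S0 Sx]] := M_Lam_dist Mx.
pose a1 := C1 ^+ 2 / (1 + C1 ^+ 2); pose a2 := (1 + C2 ^+ 2)^-1.
have a1p : 0 < a1 by rewrite divr_gt0 ?exprn_gt0// ltr_wpDr ?sqr_ge0.
have a2p : 0 < a2 by rewrite invr_gt0 ltr_wpDr ?sqr_ge0.
pose a := Num.min a1 a2.
have ap : 0 < a by rewrite lt_min a1p a2p.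
exists (a / 4); first by rewrite divr_gt0.
near=> k.
have /andP[b1 b2] : C1 * normc (Lam k).2 <= normc (Lam k).1 <= C2 * normc (Lam k).2.
  by near: k.
(* Each moment is at least [(a (W - 1) - S) / 2], by [|x|^2 >= |Lambda|^2 / 2 - S] in each
   component; beyond this threshold that is at least [a W / 4]. *)
have hW : 2 * (a + S) / a <= W k by near: k; exact: weight_unbounded.
move: hW; rewrite ler_pdivrMr// => hW.
have := weightE Lam k; have := Sx k.
have := normc_sqrD ((Lam k).1 - (x k).1) (x k).1.
have := normc_sqrD ((Lam k).2 - (x k).2) (x k).2; rewrite !subrK.
rewrite (normc_distC (Lam k).1) (normc_distC (Lam k).2).
have := sqr_ge0 (normc ((x k).1 - (Lam k).1)).
have := sqr_ge0 (normc ((x k).2 - (Lam k).2)).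
have p0 := normc_ge0 (Lam k).1; have q0 := normc_ge0 (Lam k).2.
have h1 : a * (normc (Lam k).1 ^+ 2 + normc (Lam k).2 ^+ 2) <= normc (Lam k).1 ^+ 2.
  apply: (@le_trans _ _ (a1 * (normc (Lam k).1 ^+ 2 + normc (Lam k).2 ^+ 2))).
    by rewrite ler_wpM2r ?addr_ge0 ?sqr_ge0// ge_min lexx.
  rewrite /a1 mulrAC ler_pdivrMr; last by rewrite ltr_wpDr ?sqr_ge0.
  have : (C1 * normc (Lam k).2) ^+ 2 <= normc (Lam k).1 ^+ 2.
    by rewrite ler_sqr ?nnegrE// mulr_ge0// ltW.
  rewrite exprMn; lra.
have h2 : a * (normc (Lam k).1 ^+ 2 + normc (Lam k).2 ^+ 2) <= normc (Lam k).2 ^+ 2.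
  apply: (@le_trans _ _ (a2 * (normc (Lam k).1 ^+ 2 + normc (Lam k).2 ^+ 2))).
    by rewrite ler_wpM2r ?addr_ge0 ?sqr_ge0// ge_min lexx orbT.
  rewrite /a2 mulrC ler_pdivrMr; last by rewrite ltr_wpDr ?sqr_ge0.
  have : normc (Lam k).1 ^+ 2 <= (C2 * normc (Lam k).2) ^+ 2.
    by rewrite ler_sqr ?nnegrE// mulr_ge0// ltW.
  rewrite exprMn; lra.
rewrite /moment1 /moment2 => *.
by split; nra.
Unshelve. all: by end_near. Qed.

(** Finitely many indices remain. Where [z_k w_k] is nonzero both moments are positive, so a minimum
    of finitely many ratios to [W] serves. *)
Lemma moment_ge x (c : R) : 0 < c ->
    (\forall k \near \oo, c * W k <= moment1 x k /\ c * W k <= moment2 x k) ->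
  exists2 c' : R, 0 < c' & forall k, (x k).1 * (x k).2 != 0 ->
    c' * W k <= moment1 x k /\ c' * W k <= moment2 x k.
Proof.
move=> c0 [K _ HK].
suff [c' c'0 Hc'] : exists2 c' : R, 0 < c' & forall k, (k < K)%N ->
    (x k).1 * (x k).2 != 0 -> c' * W k <= moment1 x k /\ c' * W k <= moment2 x k.
  exists (Num.min c c') => [|k zw]; first by rewrite lt_min c0 c'0.
  have [kK|Kk] := ltnP k K.
    have [m1 m2] := Hc' k kK zw.
    by split; [apply: le_trans m1|apply: le_trans m2];
      rewrite ler_wpM2r ?(ltW (W0 k))// ge_min lexx orbT.
  have [m1 m2] := HK k Kk.
  by split; [apply: le_trans m1|apply: le_trans m2];
    rewrite ler_wpM2r ?(ltW (W0 k))// ge_min lexx.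
elim: K {HK} => [|K [c1 c10 IH]]; first by exists 1.
have [zwK|zwK] := eqVneq ((x K).1 * (x K).2) 0.
  exists c1 => // k; rewrite ltnS leq_eqVlt => /predU1P[->|kK]; last exact: IH.
  by rewrite zwK eqxx.
have [zK wK] : 0 < moment1 x K /\ 0 < moment2 x K.
  move: zwK; rewrite mulf_eq0 negb_or -!normc_eq0 => /andP[z0 w0].
  by split; rewrite divr_gt0// exprn_gt0// lt_neqAle eq_sym ?z0 ?w0 normc_ge0.
pose m := Num.min (moment1 x K) (moment2 x K) / W K.
have m0 : 0 < m by rewrite divr_gt0// lt_min zK wK.
exists (Num.min c1 m) => [|k]; first by rewrite lt_min c10 m0.
rewrite ltnS leq_eqVlt => /predU1P[-> _|kK zw].
  have mW : Num.min c1 m * W K <= m * W K.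
    by rewrite ler_wpM2r ?(ltW (W0 K))// ge_min lexx orbT.
  move: mW; rewrite {2}/m divfK ?gt_eqF// le_min => /andP[//].
have [m1 m2] := IH k kK zw.
by split; [apply: le_trans m1|apply: le_trans m2];
  rewrite ler_wpM2r ?(ltW (W0 k))// ge_min lexx.
Qed.

Hypothesis u_spanning : spanning (R := R) u.
Hypothesis beta_linear : linear_on (t_lam Lam) beta.
Hypothesis beta_coord : forall k, beta (coord_vec k) = real_row (u k).
Hypothesis beta_continuous : continuous_on Lam (t_lam Lam) beta.
Hypothesis flats_disjoint : forall f : 'I_n.+1 -> nat, injective f ->
  \bigcap_(i in [set: 'I_n.+1]) flat Lam u (f i) = set0.

Local Notation nn := (lie_N Lam beta).

Let sN : subspace nn. Proof. exact: lie_N_subspace. Qed.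

Lemma beta_bounded :
  exists M, forall t, t_lam Lam t -> `|beta t| <= M * wnorm W t.
Proof.
by apply: (bounded_of_continuous st _ beta_linear beta_continuous).
Qed.

Lemma lie_N_closed (T : nat -> nat -> R) t : (forall m, nn (T m)) -> wl2 W t ->
  wsq W (fun k => T m k - t k) @[m --> \oo] --> (0 : R) -> nn t.
Proof.
move=> NT wt T0; split=> //.
have [M bM] := beta_bounded.
have bnd m : `|beta t| <= `|M| * Num.sqrt (wsq W (fun k => T m k - t k)).
  have [Tm bT] := NT m; have wd := subspaceB st Tm wt.
  have := bM _ wd; rewrite (linear_onB beta_linear Tm wt) bT sub0r normrN.
  by move=> /le_trans; apply; rewrite ler_wpM2r ?wnorm_ge0// ler_norm.
have lim0 : (`|M| * Num.sqrt (wsq W (fun k => T m k - t k)) : R^o)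
    @[m --> \oo] --> (`|M| * Num.sqrt 0 : R^o).
  by apply: cvgMr; apply: continuous_cvg T0; exact: sqrt_continuous.
rewrite sqrtr0 mulr0 in lim0.
apply/normr0_eq0/eqP; rewrite eq_le normr_ge0 andbT.
apply: (ler_cvg_to (cvg_cst (`|beta t| : R^o)) lim0).
exact: nearW.
Qed.

(** A finite linear relation among the [u_k] is a finitely supported element of n, on which the
    series for mu^C is a finite sum. *)
Lemma muC_zero_functional x : muC_zero Lam beta x ->
  exists a : 'cV[R[i]]_n, forall k,
    (map_mx intr (u k) *m a) 0 0 = imC (mu_coef Lam x k).
Proof.
move=> [Mx mux]; apply: (functional_of_relations u_spanning) => t m t0 tu.
have wt := wl2_finsupp t0.
have Nt : nn t.
  by split; [exact: wt|rewrite (linear_finsupp W1 beta_linear beta_coord t0)].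
rewrite -[RHS](mux t Nt) /muC; apply/esym; apply: (@cvg_lim R[i]^o); first exact: norm_hausdorff.
apply: (@cvg_series_finsupp _ R[i]^o _ m) => k mk.
by rewrite t0// rmorph0 mulr0.
Qed.

(* The coordinates of t at which z_k w_k = 0 are controlled by the other ones:
   the corresponding flats share the point a_C, so the u_k are independent. *)
Lemma lie_N_coercive x (K : nat) : muC_zero Lam beta x ->
    (forall k, (K <= k)%N -> (x k).1 * (x k).2 != 0) ->
  exists2 D : R, 0 < D & forall t, nn t -> wsq W t <=
    D * limn (series (fun k => if (x k).1 * (x k).2 != 0
                               then W k * `|t k| ^+ 2 else 0)).
Proof.
move=> x0 GK; pose G k := (x k).1 * (x k).2 != 0.
have [a aE] := muC_zero_functional x0.
pose L := [seq k <- iota 0 K | ~~ G k].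
have uL : uniq L by rewrite filter_uniq// iota_uniq.
have LP k : (k \in L) = ~~ G k.
  rewrite mem_filter mem_iota/= add0n; have [Gk|nGk]//= := boolP (G k).
  by rewrite ltnNge; apply: contra nGk => /GK.
have free : row_free (rows (fun k => map_mx intr (u k) : 'rV[R[i]]_n) L).
  apply: (@rows_free _ _ _ (fun k => imC (lambda Lam k)) _ _ L a) => //.
  - by move=> m U; exact: spanning_not_sub.
  - move=> f fi [b fb].
    have : (\bigcap_(i in [set: 'I_n.+1]) flat Lam u (f i)) b by move=> i _; exact: fb.
    by rewrite flats_disjoint.
  (* Where [z_k w_k = 0] the coefficient of mu^C is [lambda_k^C] alone, so [a] lies on the k-th
     flat. *)
  move=> k; rewrite LP negbK aE imC_mu_coef => /eqP ->; exact: addr0.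
have {free}free : row_free (rows (fun k => real_row (R := R) (u k)) L).
  move: free; congr (is_true _); rewrite -(row_free_map (real_complex R)).
  by congr row_free; apply/matrixP => i j; rewrite !mxE rmorph_int.
have [P P0 HP] := row_free_bound free.
have [M bM] := beta_bounded.
(* Every coordinate outside [G] has index below [K] and will be at most [P M] times the norm of
   [tG]. *)
pose cst := \sum_(0 <= k < K) W k * (P * M) ^+ 2.
have cst0 : 0 <= cst.
  by apply: sumr_ge0 => k _; rewrite mulr_ge0 ?sqr_ge0// ltW.
exists (1 + cst) => [|t [tt bt]]; first by rewrite ltr_wpDr.
pose tG k := if G k then t k else 0.
pose tI k := if G k then 0 else t k.
have tGE k : W k * `|tG k| ^+ 2 = if G k then W k * `|t k| ^+ 2 else 0.
  by rewrite /tG; case: ifP => // _; rewrite normr0 expr0n/= mulr0.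
have wG : wl2 W tG.
  apply: (summable_seq_le _ tt) => k; rewrite ger0_norm ?wterm_ge0//; last exact: W1.
  by rewrite tGE; case: ifP => // _; rewrite (wterm_ge0 W1 t).
have tI0 k : (K <= k)%N -> tI k = 0 by rewrite /tI /G => /GK ->.
have wI := wl2_finsupp (W := W) tI0.
have tGI : t = fun k => tG k + tI k.
  by apply: funext => k; rewrite /tG /tI; case: ifP; rewrite ?addr0 ?add0r.
have sumG : wsq W tG = limn (series (fun k => if G k then W k * `|t k| ^+ 2 else 0)).
  by congr (limn (series _)); apply: funext.
rewrite -sumG.
(* Since [beta t = 0], the image of the finite part [tI] is bounded by the norm of [tG];
   independence of the rows then bounds [tI] itself. *)
have bI : beta tI = - beta tG.
  apply/eqP; rewrite -addr_eq0 addrC -(linear_onD beta_linear wG wI) -tGI.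
  exact/eqP.
have coordI k : ~~ G k -> `|t k| <= P * M * wnorm W tG.
  rewrite -LP => kL; have ki : (index k L < size L)%N by rewrite index_mem.
  pose tau : 'rV[R]_(size L) := \row_i t (nth 0%N L i).
  have := HP tau (Ordinal ki); rewrite mxE/= nth_index//.
  have -> : tau *m rows (fun k => real_row (u k)) L = beta tI.
    rewrite (linear_finsupp W1 beta_linear beta_coord tI0) mulmx_sum_row.
    under eq_bigr do rewrite row_rows mxE.
    rewrite (eq_bigr (fun k => if ~~ G k then t k *: real_row (u k) else 0)); last first.
      by move=> j _; rewrite /tI; case: (G j) => //=; rewrite scale0r.
    rewrite -big_mkcond/= -[RHS]big_filter.
    by rewrite /index_iota subn0 -/L (big_nth 0%N) big_mkord.
  rewrite bI normrN => /le_trans; apply; rewrite -mulrA ler_wpM2l//.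
  exact: bM.
have [_ ] : summable_seq (fun k => W k * `|t k| ^+ 2) /\ wsq W t <= (1 + cst) * wsq W tG.
  apply: ssum_bounded => [k|N]; first exact: (wterm_ge0 W1 t).
  have q0 := wsq_ge0 W1 wG.
  apply: (@le_trans _ _ (\sum_(0 <= k < N) W k * `|tG k| ^+ 2 +
      \sum_(0 <= k < N) if G k then 0 else W k * `|t k| ^+ 2)).
    rewrite -big_split/=; apply: ler_sum => k _; rewrite tGE.
    by case: (G k); rewrite ?addr0 ?add0r.
  rewrite mulrDl mul1r; apply: lerD.
    by apply: ssum_partial => // k; exact: (wterm_ge0 W1 tG).
  pose e k := if G k then 0 else W k * `|t k| ^+ 2.
  have e0 k : 0 <= e k by rewrite /e; case: ifP => // _; exact: (wterm_ge0 W1 t).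
  have eK k : (K <= k)%N -> e k = 0 by rewrite /e /G => /GK ->.
  apply: (@le_trans _ _ (\sum_(0 <= k < maxn K N) e k)).
    by apply: (nondecreasing_series (fun k _ _ => e0 k)); exact: leq_maxr.
  rewrite (sum_finsupp (leq_maxl K N) eK) /cst mulr_suml; apply: ler_sum => k _.
  rewrite /e; case: ifPn => [_|nGk].
    by rewrite mulr_ge0// mulr_ge0 ?sqr_ge0 ?(ltW (W0 k)).
  rewrite -mulrA ler_pM2l ?W0// -(wnorm_sqr W1 wG) -exprMn ler_sqr ?nnegrE ?coordI//.
  exact: le_trans (coordI k nGk).
by [].
Qed.

End MomentMap.

(** * Orbits, level sets and the bijection of quotients *)

Section Quotients.
Context {R : realType}.
Variables (n : nat) (u : nat -> 'rV[int]_n).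
Variables (Lam : nat -> quat R) (beta : (nat -> R) -> 'rV[R]_n).
Hypothesis lam_summable : summable_seq (fun k => (1 + qnorm (lambda Lam k))^-1).
Hypothesis u_spanning : spanning (R := R) u.
Hypothesis beta_linear : linear_on (t_lam Lam) beta.
Hypothesis beta_coord : forall k, beta (coord_vec k) = real_row (u k).
Hypothesis beta_continuous : continuous_on Lam (t_lam Lam) beta.
Hypothesis flats_disjoint : forall f : 'I_n.+1 -> nat, injective f ->
  \bigcap_(i in [set: 'I_n.+1]) flat Lam u (f i) = set0.
Hypothesis Lam_balanced : exists C1 C2 : R, [/\ 0 < C1, 0 < C2 &
  \forall k \near \oo,
    C1 * normc (Lam k).2 <= normc (Lam k).1 <= C2 * normc (Lam k).2].
Implicit Types (x y : nat -> quat R) (c : (nat -> R) -> R) (s t : nat -> R).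

Local Notation W := (weight Lam).
Local Notation W1 := (weight_ge1 Lam).
Local Notation NN := (grp_N Lam beta).
Local Notation NC := (grp_NC Lam beta).
Local Notation nn := (lie_N Lam beta).

Let W0 k : 0 < W k. Proof. exact: lt_le_trans (W1 k). Qed.

Let sN : subspace nn. Proof. exact: lie_N_subspace. Qed.

Lemma moment_bounds x : M_Lam Lam x -> exists C, forall k,
  moment1 x k <= C * W k /\ moment2 x k <= C * W k.
Proof.
move=> /M_Lam_le[C Cx]; exists (C / 2) => k; have [z w] := Cx k.
by rewrite /moment1 /moment2; lra.
Qed.

Lemma moment_ge0 x k : 0 <= moment1 x k /\ 0 <= moment2 x k.
Proof. by split; rewrite divr_ge0// sqr_ge0. Qed.

(** Hence exp(i t) x lies on the level [c] exactly when [t] is critical for the energy with linear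
    term [c - mu^R(x)]. *)
Lemma muR_denergy x c t s : M_Lam Lam x -> nn t -> nn s ->
  muR Lam (act (iexp t) x) s = c s -
    denergy (moment1 x) (moment2 x) (fun s => c s - muR Lam x s) t s.
Proof.
move=> Mx [wt _] [ws _]; have [C Cx] := moment_bounds Mx.
have [cm _] := dual_summable W1 (muR_dual Mx) ws.
have [cg _] := dual_summable W1 (grad_dual W1 (moment_ge0 x) Cx wt) ws.
rewrite /denergy /muR.
rewrite (_ : (fun k => imR (mu_coef Lam (act _ x) k) * s k) = fun k =>
    imR (mu_coef Lam x k) * s k - grad (moment1 x) (moment2 x) k (t k) * s k).
  by rewrite ssumB//; ring.
by apply: funext => k; rewrite imR_mu_iexp mulrBl.
Qed.

Lemma iexp_level x c : muC_zero Lam beta x -> in_dual Lam nn c ->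
  exists t, [/\ nn t, muR_level Lam beta c (act (iexp t) x) &
    forall s, nn s -> muR_level Lam beta c (act (iexp s) x) -> s = t].
Proof.
move=> x0 [c_lin c_cont]; have Mx := x0.1.
have [C Cx] := moment_bounds Mx.
have [c1 c10 near1] := moment_ge_near lam_summable Lam_balanced Mx.
have [c2 c20 lower] := moment_ge c10 near1.
(* Beyond some index both moments are positive, so [z_k w_k] vanishes only finitely often. *)
have [K GK] : exists K, forall k, (K <= k)%N -> (x k).1 * (x k).2 != 0.
  have [K _ HK] := near1; exists K => k Kk; have [m1 m2] := HK k Kk.
  have cW : 0 < c1 * W k by rewrite mulr_gt0.
  apply/negP; rewrite mulf_eq0 -!normc_eq0 => /orP[] /eqP z.
    by move: (lt_le_trans cW m1); rewrite /moment1 z expr0n/= mul0r ltxx.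
  by move: (lt_le_trans cW m2); rewrite /moment2 z expr0n/= mul0r ltxx.
have [D D0 coer] := lie_N_coercive u_spanning beta_linear beta_coord
  beta_continuous flats_disjoint x0 GK.
have nwl : nn `<=` wl2 W by move=> t [].
have [M1 bM1] := bounded_of_continuous (V := R) sN nwl c_lin c_cont.
have [M2 bM2] := dual_bounded W1 (muR_dual Mx).
pose l s := c s - muR Lam x s.
have l_lin : linear_on (V := R) nn l.
  move=> a s t ns nt; rewrite /l c_lin//.
  rewrite /muR (dual_linear W1 (muR_dual Mx) a (nwl _ ns) (nwl _ nt)).
  by rewrite scalerBr; ring.
have l_bnd t : nn t -> `|l t| <= (M1 + M2) * wnorm W t.
  move=> nt; apply: le_trans (ler_normB _ _) _.
  by rewrite mulrDl lerD ?bM1//; apply: bM2; exact: nwl.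
pose G k := (x k).1 * (x k).2 != 0.
have closed := lie_N_closed beta_linear beta_continuous.
have [t nt tmin] := energy_minimizer W1 (moment_ge0 x) Cx (G := G) c20 lower D0
  sN nwl closed coer l_lin l_bnd.
have tcrit := minimizer_critical W1 (moment_ge0 x) Cx sN nwl l_lin nt tmin.
exists t; split=> //.
  split=> [|s ns]; first exact: act_iexp_M_Lam (nwl _ nt) Mx.
  by rewrite (muR_denergy c)// tcrit// subr0.
move=> s ns [_ ls]; apply/esym.
apply: (critical_unique W1 (moment_ge0 x) Cx (G := G) c20 lower D0 sN nwl coer
  l_lin nt ns tcrit) => h nh.
have := ls h nh; rewrite (muR_denergy c)// -/l => /eqP.
by rewrite -subr_eq0 addrAC subrr sub0r oppr_eq0 => /eqP.
Qed.

(** An element of N^C is [g exp(i s)] with [g] in N. As N preserves mu^R, [g] can be stripped off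
    without leaving the level, and uniqueness in n gives [s = t]. *)
Lemma orbit_level x c : muC_zero Lam beta x -> in_dual Lam nn c ->
  exists2 y, (orbit_of NC x `&` muR_level Lam beta c) y &
    orbit_of NC x `&` muR_level Lam beta c = orbit_of NN y.
Proof.
move=> x0 cd; have [t [nt lt uniq_t]] := iexp_level x0 cd.
have Ot : orbit_of NC x (act (iexp t) x).
  by exists (iexp t) => //; exact: grp_NC_iexp.
exists (act (iexp t) x) => //; apply/seteqP; split=> [y [Oy ly]|y Oy].
  case: Oy ly => h [g [s [Ng ns ->]]] <- ly.
  rewrite -/(iexp s) in ly *.
  have g0 k : g k != 0 by exact: T_lam_neq0 (grp_N_T Ng).
  have ls : muR_level Lam beta c (act (iexp s) x).
    have := muR_level_act (grp_NV beta_linear Ng) ly.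
    by rewrite actM (actK _ g0).
  rewrite -(uniq_t s ns ls); exists g; first exact: Ng.
  exact: esym (actM _ _ _).
split.
  by rewrite -(orbit_NC_eq beta_linear Ot); exact: orbit_N_NC.
by case: Oy => g Ng <-; exact: muR_level_act.
Qed.

Lemma in_dual0 : in_dual Lam nn (fun=> 0).
Proof.
split=> [a s t _ _|t _ e e0]; first by rewrite scaler0 addr0.
by exists 1 => // s _ _; rewrite subrr normr0.
Qed.

Lemma quotient_bijection :
  exists F : set (nat -> quat R) -> set (nat -> quat R),
    (forall x, mu_zero Lam beta x -> F (orbit_of NN x) = orbit_of NC x) /\
    set_bij [set orbit_of NN x | x in mu_zero Lam beta]
            [set orbit_of NC x | x in muC_zero Lam beta] F.
Proof.
(* A union avoids choosing a representative; over an N-orbit all the N^C-orbits in it coincide. *)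
pose F (O : set (nat -> quat R)) := \bigcup_(x in O) orbit_of NC x.
have FE x : F (orbit_of NN x) = orbit_of NC x.
  apply/seteqP; split=> [y [z /(orbit_N_NC beta_linear) Oz]|y Oy].
    by rewrite (orbit_NC_eq beta_linear Oz).
  by exists x => //; exact: orbit_N_refl.
(* The N-orbit is recovered from the N^C-orbit, which yields injectivity. *)
have level0 x : mu_zero Lam beta x ->
    orbit_of NN x = orbit_of NC x `&` muR_level Lam beta (fun=> 0).
  move=> [lx x0]; have [y _ E] := orbit_level x0 in_dual0.
  rewrite E; apply: orbit_N_eq => //; rewrite -E; split=> //.
  by apply: orbit_N_NC => //; exact: orbit_N_refl.
exists F; split=> [x _|]; first exact: FE.
split.
- by move=> _ [x [_ x0] <-]; exists x => //; rewrite FE.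
- move=> _ _ /set_mem[x xm <-] /set_mem[y ym <-]; rewrite !FE => E.
  by rewrite (level0 x)// (level0 y)// E.
move=> _ [x x0 <-]; have [y [Oy ly] _] := orbit_level x0 in_dual0.
exists (orbit_of NN y); last by rewrite FE (orbit_NC_eq beta_linear Oy).
exists y => //; split=> //.
by case: Oy => g Ng <-; exact: muC_zero_act.
Qed.

End Quotients.

Unset Implicit Arguments.

Theorem mainTheorem2 (R : realType) (n : nat) (u : nat -> 'rV[int]_n)
  (Lam : nat -> quat R) (beta : (nat -> R) -> 'rV[R]_n)
  (lam_summable : summable_seq (fun k => (1 + qnorm (lambda Lam k))^-1))
  (u_primitive : forall k, primitive (u k))
  (u_spanning : spanning (R := R) u)
  (beta_linear : linear_on (t_lam Lam) beta)
  (beta_coord : forall k, beta (coord_vec k) = real_row (u k))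
  (beta_continuous : continuous_on Lam (t_lam Lam) beta)
  (flats_disjoint : forall f : 'I_n.+1 -> nat, injective f ->
     \bigcap_(i in [set: 'I_n.+1]) flat Lam u (f i) = set0)
  (lam_growth : exists delta : R, 1 < delta /\
     exists c1 c2 : R, [/\ 0 < c1, 0 < c2 &
       \forall k \near \oo,
         c1 * k.+1%:R `^ delta <= qnorm (lambda Lam k) <= c2 * k.+1%:R `^ delta])
  (Lam_balanced : exists C1 C2 : R, [/\ 0 < C1, 0 < C2 &
       \forall k \near \oo,
         C1 * normc (Lam k).2 <= normc (Lam k).1 <= C2 * normc (Lam k).2]) :
  (forall (x : nat -> quat R) (c : (nat -> R) -> R),
     muC_zero Lam beta x -> in_dual Lam (lie_N Lam beta) c ->
     exists2 y : nat -> quat R,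
       (orbit_of (grp_NC Lam beta) x `&` muR_level Lam beta c) y &
       orbit_of (grp_NC Lam beta) x `&` muR_level Lam beta c
         = orbit_of (grp_N Lam beta) y) /\
  (exists F : set (nat -> quat R) -> set (nat -> quat R),
     (forall x, mu_zero Lam beta x ->
        F (orbit_of (grp_N Lam beta) x) = orbit_of (grp_NC Lam beta) x) /\
     set_bij [set orbit_of (grp_N Lam beta) x | x in mu_zero Lam beta]
             [set orbit_of (grp_NC Lam beta) x | x in muC_zero Lam beta] F).
Proof.
split=> [x c x0 cd|]; first exact: (orbit_level lam_summable u_spanning).
exact: (quotient_bijection lam_summable u_spanning).
Qed.
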